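(* For all complex $q$ with $|q|<1$, $$\mathcal{P}_{0,2}(q)\big(-1+\mathcal{P}(q)\big)=\frac18+\frac1{16}\big(\mathcal{Q}(q)+\mathcal{Q}(q^2)\big)-\frac1{24}\big(\mathcal{E}(q)-7\mathcal{E}(q^2)\big)-\frac12\mathcal{P}(q^2)+\frac12q\frac{d\mathcal{P}(q)}{dq}-\frac1{12}\Big(q\frac{d\mathcal{E}(q)}{dq}-q\frac{d\mathcal{E}(q^2)}{dq}\Big),$$ $$\mathcal{P}_{0,2}(q)\big(-1+\mathcal{P}(q^2)\big)=\frac18+\frac18\big(\mathcal{Q}(q^2)-3\mathcal{P}(q^2)+\mathcal{E}(q^2)\big)+\frac1{16}\Big(q\frac{d\mathcal{P}(q)}{dq}+6q\frac{d\mathcal{P}(q^2)}{dq}\Big)-\frac1{48}\Big(q\frac{d\mathcal{E}(q)}{dq}+2q\frac{d\mathcal{E}(q^2)}{dq}\Big),$$ $$\mathcal{P}_{1,2}(q)\big(-1+\mathcal{P}(q)\big)=\frac1{16}\big(\mathcal{Q}(q)-\mathcal{Q}(q^2)\big)-\frac1{24}\big(\mathcal{E}(q)-\mathcal{E}(q^2)\big)+\frac1{12}\Big(q\frac{d\mathcal{E}(q)}{dq}-q\frac{d\mathcal{E}(q^2)}{dq}\Big),$$ $$\mathcal{P}_{1,2}(q)\big(-1+\mathcal{P}(q^2)\big)=\frac1{24}\big(\mathcal{E}(q^2)-\mathcal{E}(q)\big)+\frac1{24}\Big(q\frac{d\mathcal{E}(q)}{dq}-q\frac{d\mathcal{E}(q^2)}{dq}\Big),$$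 $$\mathcal{E}_{0,2}(q)\big(-1+\mathcal{P}(q)\big)=\frac1{24}+\frac1{16}\Big(\mathcal{Q}(q^2)-\frac13\mathcal{Q}(q)\Big)-\frac1{24}\mathcal{P}(q)-\frac1{24}\mathcal{E}(q^2)+\frac1{12}q\frac{d\mathcal{E}(q^2)}{dq},$$ $$\mathcal{E}_{0,2}(q)\big(-1+\mathcal{P}(q^2)\big)=\frac1{24}+\frac1{24}\big(\mathcal{Q}(q^2)-\mathcal{P}(q^2)-\mathcal{E}(q^2)\big)+\frac1{24}q\frac{d\mathcal{E}(q^2)}{dq}.$$
   Context: For $s,n\in\mathbb{N}$ (positive integers), $\widetilde{\sigma}_s(n)=\sum_{d\mid n}(-1)^{d-1}d^s$ and $\widehat{\sigma}_s(n)=\sum_{d\mid n}(-1)^{\frac nd-1}d^s$; write $\widetilde{\sigma}=\widetilde{\sigma}_1$, $\widehat{\sigma}=\widehat{\sigma}_1$, and set $\widetilde{\sigma}_s(n)=\widehat{\sigma}_s(n)=0$ if $n$ is not a positive integer (in particular at $n=0$). For $|q|<1$, $$\mathcal{P}(q)=1+8\sum_{n=1}^\infty\widetilde{\sigma}(n)q^n,\quad \mathcal{E}(q)=1+24\sum_{n=1}^\infty\widehat{\sigma}(n)q^n,\quad \mathcal{Q}(q)=1-16\sum_{n=1}^\infty\widetilde{\sigma}_3(n)q^n,$$ and for $r\in\{0,1\}$, $$\mathcal{P}_{r,2}(q)=\sum_{n=0}^\infty\widetilde{\sigma}(2n+r)q^{2n+r},\qquad \mathcal{E}_{r,2}(q)=\sum_{n=0}^\infty\widehat{\sigma}(2n+r)q^{2n+r}.$$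 The notation $\frac{d\mathcal{P}(q^2)}{dq}$ means the derivative with respect to $q$ of the composite function $q\mapsto\mathcal{P}(q^2)$, and similarly for $\mathcal{E}$. *)

(* Defs.v *)
From Stdlib Require Export Reals List ZArith.
From Coquelicot Require Export Coquelicot.

Definition divisors (n : nat) : list nat :=
  filter (fun d => Nat.eqb (Nat.modulo n d) 0) (seq 1 n).

Definition Zsum (l : list nat) (f : nat -> Z) : Z :=
  fold_right Z.add 0%Z (map f l).

(** Both functions vanish at [n = 0], since [divisors 0] is empty; the
    truncated subtractions are exact because every divisor [d] of [n]
    satisfies [1 <= d <= n]. *)
Definition sigma_tilde (s n : nat) : Z :=
  Zsum (divisors n)
    (fun d => ((-1) ^ Z.of_nat (d - 1) * Z.of_nat d ^ Z.of_nat s)%Z).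

Definition sigma_hat (s n : nat) : Z :=
  Zsum (divisors n)
    (fun d => ((-1) ^ Z.of_nat (n / d - 1) * Z.of_nat d ^ Z.of_nat s)%Z).

Definition ZtoC (z : Z) : C := RtoC (IZR z).

(** Sum of a complex series, by the description operator [iota] of the complete
    space [C]; see [CSeries_unique]. *)
Definition CSeries (a : nat -> C) : C :=
  @iota C_CompleteNormedModule
    (fun l => @is_series C_AbsRing C_NormedModule a l).

Lemma CSeries_unique (a : nat -> C) (l : C) :
  @is_series C_AbsRing C_NormedModule a l -> CSeries a = l.
Proof.
intros H.
exact (@iota_filterlim_locally C_AbsRing C_CompleteNormedModule nat eventually
         _ (sum_n a) l H).
Qed.

Open Scope C_scope.

Definition calP (q : C) : C :=
  1 + 8 * CSeries (fun n => ZtoC (sigma_tilde 1 (S n)) * q ^ S n).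

Definition calE (q : C) : C :=
  1 + 24 * CSeries (fun n => ZtoC (sigma_hat 1 (S n)) * q ^ S n).

Definition calQ (q : C) : C :=
  1 - 16 * CSeries (fun n => ZtoC (sigma_tilde 3 (S n)) * q ^ S n).

Definition calP_2 (r : nat) (q : C) : C :=
  CSeries (fun n => ZtoC (sigma_tilde 1 (2 * n + r)) * q ^ (2 * n + r)).

Definition calE_2 (r : nat) (q : C) : C :=
  CSeries (fun n => ZtoC (sigma_hat 1 (2 * n + r)) * q ^ (2 * n + r)).

(** [C_derive] is computed from the limit along the horizontal line through
    [q]; it is the complex derivative wherever [ex_C_derive] holds
    ([C_derive_correct]). *)
Definition ex_C_derive (f : C -> C) (q : C) : Prop :=
  @ex_derive C_AbsRing C_NormedModule f q.

(* Main.v *)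
Require Import Defs.
From Stdlib Require Import Lia Lra Permutation.

(** Put [L(q) = sum sigma_1(n) q^n], [M(q) = sum sigma_3(n) q^n] and
    [D = q dL/dq].  Separating even divisors [d] (for [sigma_tilde]) or even
    codivisors [n/d] (for [sigma_hat]) gives
    [sigma_tilde_s(n) = sigma_s(n) - 2^(s+1) sigma_s(n/2)] and
    [sigma_hat_s(n) = sigma_s(n) - 2 sigma_s(n/2)], so the functions P, E, Q, the
    partial series with a fixed parity, and the derivatives are all linear
    combinations of the values of L, M, D at [q], [q^2], [q^4].  The six identities
    therefore follow from linear expressions, in terms of such values, for the
    products of two of [L(q)], [L(q^2)], [L(q^4)]:

    - [12 L(q)^2 = 5 M(q) + L(q) - 6 D(q)] ([L_square]);
    - the formula for [L(q) L(q^2)] ([L_mul_L2]);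
    - the formula for [L(q) L(q^4)] ([L_mul_L4]).

    The first two are statements on convolution sums of divisor functions, and come
    from one elementary identity of Liouville ([liouville]): for every function [F]
    on the natural numbers, the sum of [F(|a-b|) - F(a+b)] over all positive
    solutions of [a x + b y = n] is a sum over the divisors of [n].  The choice
    [F(l) = l^2] makes the summand [-4 a b] and yields [L(q)^2].  The choice
    [F(l) = l^2] for even [l] and [0] for odd [l] keeps the [a], [b] of equal
    parity, and yields [(L(q) - 2 L(q^2))^2 + 4 L(q^2)^2], hence [L(q) L(q^2)].
    The third product needs no new arithmetic: since
    [L(-q) = - L(q) + 6 L(q^2) - 4 L(q^4)] ([L_opp]), the first formula at
    [-q] contains [L(q) L(q^4)] next to products that are already known.

    Liouville's identity itself rests on one bijection, the step
    [(a, x, b, y) -> (a, x - y, a + b, y)] of the Euclidean algorithm applied to the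
    solutions of [a x + b y = n] with [x > y] ([qsum_transfer]).

    On the analytic side, integer sequences of polynomial growth are closed under the
    linear operations involved; their power series converge on the unit disc, may be
    multiplied there ([sums_to_conv]) and have a complex derivative obtained
    term by term ([is_derive_power_series]). *)

Local Open Scope Z_scope.

(** * Finite sums *)

Definition lsum {A : Type} (l : list A) (f : A -> Z) : Z :=
  fold_right Z.add 0 (map f l).

Lemma lsum_ext {A : Type} (l : list A) (f g : A -> Z) :
  (forall x, In x l -> f x = g x) -> lsum l f = lsum l g.
Proof.
  intros H; unfold lsum; induction l as [|x l IH]; simpl; [reflexivity|].
  rewrite H by (left; reflexivity).
  rewrite IH; [reflexivity|]. intros y Hy; apply H; right; exact Hy.
Qed.

Lemma lsum_cons {A : Type} (x : A) l (f : A -> Z) : lsum (x :: l) f = f x + lsum l f.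
Proof. reflexivity. Qed.

Lemma lsum_add {A : Type} (l : list A) (f g : A -> Z) :
  lsum l (fun x => f x + g x) = lsum l f + lsum l g.
Proof. induction l as [|x l IH]; [reflexivity|]. rewrite !lsum_cons, IH; ring. Qed.

Lemma lsum_scal {A : Type} (l : list A) c (f : A -> Z) :
  lsum l (fun x => c * f x) = c * lsum l f.
Proof.
  induction l as [|x l IH]; [unfold lsum; simpl; ring|].
  rewrite !lsum_cons, IH; ring.
Qed.

Lemma lsum_sub {A : Type} (l : list A) (f g : A -> Z) :
  lsum l (fun x => f x - g x) = lsum l f - lsum l g.
Proof. induction l as [|x l IH]; [reflexivity|]. rewrite !lsum_cons, IH; ring. Qed.

Lemma lsum_app {A : Type} (l m : list A) (f : A -> Z) :
  lsum (l ++ m) f = lsum l f + lsum m f.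
Proof.
  induction l as [|x l IH]; [reflexivity|].
  simpl app; rewrite !lsum_cons, IH; ring.
Qed.

Lemma lsum_map {A B : Type} (g : A -> B) l (f : B -> Z) :
  lsum (map g l) f = lsum l (fun x => f (g x)).
Proof. unfold lsum; rewrite map_map; reflexivity. Qed.

Lemma lsum_filter {A : Type} (p : A -> bool) l (f : A -> Z) :
  lsum (filter p l) f = lsum l (fun x => if p x then f x else 0).
Proof.
  induction l as [|x l IH]; [reflexivity|].
  simpl; rewrite lsum_cons, <- IH; destruct (p x); reflexivity.
Qed.

Lemma lsum_perm {A : Type} (l m : list A) (f : A -> Z) :
  Permutation l m -> lsum l f = lsum m f.
Proof.
  induction 1 as [|x l m _ IH|x y l|l m k _ IH1 _ IH2]; try rewrite !lsum_cons; try lia.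
Qed.

Lemma lsum_const {A : Type} (l : list A) c :
  lsum l (fun _ => c) = Z.of_nat (length l) * c.
Proof.
  induction l as [|x l IH]; [reflexivity|].
  rewrite lsum_cons, IH; simpl length; rewrite Nat2Z.inj_succ; ring.
Qed.

(** All changes of variables below are instances of this one: the two sums are
    matched by a bijection between the terms selected by [p] and those selected by [r],
    given with its inverse so that injectivity needs no separate argument. *)
Lemma lsum_reindex {A B : Type} (l : list A) (m : list B) (p : A -> bool)
    (r : B -> bool) (g : A -> B) (h : B -> A) (u : A -> Z) (v : B -> Z) :
  NoDup l -> NoDup m ->
  (forall x, In x l -> p x = true ->
     In (g x) m /\ r (g x) = true /\ h (g x) = x /\ u x = v (g x)) ->
  (forall y, In y m -> r y = true ->
     In (h y) l /\ p (h y) = true /\ g (h y) = y) ->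
  lsum l (fun x => if p x then u x else 0)
  = lsum m (fun y => if r y then v y else 0).
Proof.
  intros Hl Hm Hg Hh.
  rewrite <- !lsum_filter.
  transitivity (lsum (map g (filter p l)) v).
  - rewrite lsum_map; apply lsum_ext; intros x Hx.
    apply filter_In in Hx; destruct Hx as [Hx Hp]; apply Hg; assumption.
  - apply lsum_perm, NoDup_Permutation.
    + apply NoDup_map_NoDup_ForallPairs; [|apply NoDup_filter; assumption].
      intros x y Hx Hy Hxy.
      apply filter_In in Hx, Hy; destruct Hx as [Hx Px]; destruct Hy as [Hy Py].
      destruct (Hg x Hx Px) as (_ & _ & Ex & _).
      destruct (Hg y Hy Py) as (_ & _ & Ey & _).
      congruence.
    + apply NoDup_filter; assumption.
    + intros y; rewrite in_map_iff, filter_In; split.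
      * intros [x [Ex Hx]]; apply filter_In in Hx; destruct Hx as [Hx Px].
        destruct (Hg x Hx Px) as (H1 & H2 & _); subst y; split; assumption.
      * intros [Hy Ry]; destruct (Hh y Hy Ry) as (H1 & H2 & H3).
        exists (h y); rewrite filter_In; repeat split; assumption.
Qed.

Lemma lsum_bij {A B : Type} (l : list A) (m : list B) (g : A -> B) (h : B -> A)
    (u : A -> Z) (v : B -> Z) :
  NoDup l -> NoDup m ->
  (forall x, In x l -> In (g x) m /\ h (g x) = x /\ u x = v (g x)) ->
  (forall y, In y m -> In (h y) l /\ g (h y) = y) ->
  lsum l u = lsum m v.
Proof.
  intros Hl Hm Hg Hh.
  refine (lsum_reindex l m (fun _ => true) (fun _ => true) g h u v Hl Hm _ _).
  - intros x Hx _; specialize (Hg x Hx); tauto.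
  - intros y Hy _; specialize (Hh y Hy); tauto.
Qed.

Definition dep_pairs {A B : Type} (l : list A) (m : A -> list B) : list (A * B) :=
  flat_map (fun a => map (pair a) (m a)) l.

Lemma in_dep_pairs {A B : Type} (l : list A) (m : A -> list B) a b :
  In (a, b) (dep_pairs l m) <-> In a l /\ In b (m a).
Proof.
  unfold dep_pairs; rewrite in_flat_map; split.
  - intros [a' [Ha H]]; apply in_map_iff in H; destruct H as [b' [E Hb]].
    injection E as -> ->; split; assumption.
  - intros [Ha Hb]; exists a; split; [assumption|apply in_map; assumption].
Qed.

Lemma NoDup_dep_pairs {A B : Type} (l : list A) (m : A -> list B) :
  NoDup l -> (forall a, NoDup (m a)) -> NoDup (dep_pairs l m).
Proof.
  intros Hl Hm; induction Hl as [|a l Ha Hl IH]; simpl; [constructor|].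
  apply NoDup_app.
  - apply FinFun.Injective_map_NoDup; [|apply Hm].
    intros x y E; congruence.
  - exact IH.
  - intros [a' b] H1 H2; apply in_dep_pairs in H2.
    apply in_map_iff in H1; destruct H1 as [b' [E _]].
    injection E as -> ->; tauto.
Qed.

Lemma lsum_dep_pairs {A B : Type} (l : list A) (m : A -> list B) (f : A -> B -> Z) :
  lsum (dep_pairs l m) (fun '(a, b) => f a b)
  = lsum l (fun a => lsum (m a) (f a)).
Proof.
  induction l as [|a l IH]; [reflexivity|].
  simpl dep_pairs; unfold dep_pairs in *; simpl flat_map.
  rewrite lsum_app, lsum_map, IH; reflexivity.
Qed.

(** * Sums over factorizations *)

Definition factorizations (n : nat) : list (nat * nat) :=
  map (fun d => (d, n / d)%nat) (divisors n).

Lemma in_divisors n d : In d (divisors n) <-> (1 <= d <= n /\ n mod d = 0)%nat.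
Proof.
  unfold divisors; rewrite filter_In, in_seq, Nat.eqb_eq; lia.
Qed.

Lemma in_factorizations n d e :
  In (d, e) (factorizations n) <-> (1 <= d /\ 1 <= e /\ d * e = n)%nat.
Proof.
  unfold factorizations; rewrite in_map_iff; split.
  - intros [d' [E H]]; injection E as -> <-; apply in_divisors in H.
    destruct H as [Hd Hm].
    assert (E := Nat.div_mod_eq n d); rewrite Hm in E.
    destruct (n / d)%nat; nia.
  - intros (Hd & He & <-); exists d; rewrite in_divisors.
    rewrite (Nat.mul_comm d e), Nat.div_mul, Nat.Div0.mod_mul by lia.
    repeat split; nia.
Qed.

Lemma NoDup_factorizations n : NoDup (factorizations n).
Proof.
  apply FinFun.Injective_map_NoDup; [intros x y E; congruence|].
  apply NoDup_filter, seq_NoDup.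
Qed.

(** Summing over factorizations [d * e = n] rather than over divisors makes the
    exchange of a divisor with its codivisor a symmetry of the index set. *)
Definition dsum (n : nat) (f : nat -> nat -> Z) : Z :=
  lsum (factorizations n) (fun '(d, e) => f d e).

Lemma dsum_divisors n f : dsum n f = lsum (divisors n) (fun d => f d (n / d)%nat).
Proof. unfold dsum, factorizations; rewrite lsum_map; reflexivity. Qed.

Lemma dsum_ext n f g :
  (forall d e, (1 <= d)%nat -> (1 <= e)%nat -> (d * e = n)%nat -> f d e = g d e) ->
  dsum n f = dsum n g.
Proof.
  intros H; apply lsum_ext; intros [d e] Hde; apply in_factorizations in Hde.
  apply H; tauto.
Qed.

Lemma dsum_add n f g : dsum n (fun d e => f d e + g d e) = dsum n f + dsum n g.
Proof.
  unfold dsum; rewrite <- lsum_add; apply lsum_ext; intros [d e] _; reflexivity.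
Qed.

Lemma dsum_sub n f g : dsum n (fun d e => f d e - g d e) = dsum n f - dsum n g.
Proof.
  unfold dsum; rewrite <- lsum_sub; apply lsum_ext; intros [d e] _; reflexivity.
Qed.

Lemma dsum_scal n c f : dsum n (fun d e => c * f d e) = c * dsum n f.
Proof.
  unfold dsum; rewrite <- lsum_scal; apply lsum_ext; intros [d e] _; reflexivity.
Qed.

Lemma dsum_flip n f : dsum n (fun d e => f e d) = dsum n f.
Proof.
  apply (lsum_bij _ _ (fun '(d, e) => (e, d)) (fun '(d, e) => (e, d)));
    try apply NoDup_factorizations;
    intros [d e]; rewrite in_factorizations; rewrite in_factorizations;
    repeat split; lia.
Qed.

(** * Solutions of [a x + b y = n] and Liouville's identity *)

(** A solution is stored as [((a, x), (b, y))], so that its two halves are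
    factorizations of the two summands; all unknowns are at least [1]. *)
Definition quads (n : nat) : list ((nat * nat) * (nat * nat)) :=
  let box := dep_pairs (seq 1 n) (fun _ => seq 1 n) in
  filter (fun '((a, x), (b, y)) => (a * x + b * y =? n)%nat)
    (dep_pairs box (fun _ => box)).

Lemma in_quads n a x b y :
  In ((a, x), (b, y)) (quads n)
  <-> (1 <= a /\ 1 <= x /\ 1 <= b /\ 1 <= y /\ a * x + b * y = n)%nat.
Proof.
  unfold quads; rewrite filter_In, !in_dep_pairs, !in_seq, Nat.eqb_eq.
  split; [lia|]. intros (? & ? & ? & ? & ?); repeat split; nia.
Qed.

Lemma NoDup_quads n : NoDup (quads n).
Proof.
  apply NoDup_filter; repeat (apply NoDup_dep_pairs; intros); apply seq_NoDup.
Qed.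

Definition qsum (n : nat) (f : nat -> nat -> nat -> nat -> Z) : Z :=
  lsum (quads n) (fun '((a, x), (b, y)) => f a x b y).

Lemma qsum_ext n f g :
  (forall a x b y, (1 <= a)%nat -> (1 <= x)%nat -> (1 <= b)%nat -> (1 <= y)%nat ->
     (a * x + b * y = n)%nat -> f a x b y = g a x b y) ->
  qsum n f = qsum n g.
Proof.
  intros H; apply lsum_ext; intros [[a x] [b y]] Hq; apply in_quads in Hq.
  apply H; tauto.
Qed.

Lemma qsum_add n f g :
  qsum n (fun a x b y => f a x b y + g a x b y) = qsum n f + qsum n g.
Proof.
  unfold qsum; rewrite <- lsum_add; apply lsum_ext; intros [[a x] [b y]] _; reflexivity.
Qed.

Lemma qsum_sub n f g :
  qsum n (fun a x b y => f a x b y - g a x b y) = qsum n f - qsum n g.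
Proof.
  unfold qsum; rewrite <- lsum_sub; apply lsum_ext; intros [[a x] [b y]] _; reflexivity.
Qed.

Lemma qsum_scal n c f : qsum n (fun a x b y => c * f a x b y) = c * qsum n f.
Proof.
  unfold qsum; rewrite <- lsum_scal; apply lsum_ext; intros [[a x] [b y]] _; reflexivity.
Qed.

(** Grouping the solutions by the value [k] of [a * x] splits them into a
    factorization of [k] and one of [n - k].  This is what turns identities between
    sums over solutions into identities between products of power series. *)
Lemma qsum_conv n f g :
  qsum n (fun a x b y => f a x * g b y)
  = lsum (seq 0 (S n)) (fun k => dsum k f * dsum (n - k) g).
Proof.
  transitivity
    (lsum (dep_pairs (seq 0 (S n)) (fun k =>
             dep_pairs (factorizations k) (fun _ => factorizations (n - k))))
       (fun '(_, ((a, x), (b, y))) => f a x * g b y)).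
  - apply (lsum_bij _ _ (fun '((a, x), (b, y)) => ((a * x)%nat, ((a, x), (b, y)))) snd).
    + apply NoDup_quads.
    + repeat (apply NoDup_dep_pairs; intros);
        first [apply seq_NoDup | apply NoDup_factorizations].
    + intros [[a x] [b y]] H; apply in_quads in H.
      rewrite !in_dep_pairs, !in_factorizations, in_seq; repeat split; nia.
    + intros [k [[a x] [b y]]] H.
      rewrite !in_dep_pairs, !in_factorizations, in_seq in H.
      cbn [snd]; rewrite in_quads; split; [lia|].
      replace (a * x)%nat with k by lia; reflexivity.
  - etransitivity.
    + exact (lsum_dep_pairs (seq 0 (S n)) _
               (fun _ (t : (nat * nat) * (nat * nat)) =>
                  let '((a, x), (b, y)) := t in f a x * g b y)).
    + apply lsum_ext; intros k _.
      transitivity (lsum (factorizations k) (fun p =>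
        lsum (factorizations (n - k)) (fun r =>
          (let '(a, x) := p in f a x) * (let '(b, y) := r in g b y)))).
      * rewrite <- lsum_dep_pairs; apply lsum_ext; intros [[a x] [b y]] _; reflexivity.
      * unfold dsum; rewrite Z.mul_comm, <- lsum_scal; apply lsum_ext.
        intros p _; rewrite lsum_scal; ring.
Qed.

Lemma qsum_swap n f : qsum n (fun a x b y => f b y a x) = qsum n f.
Proof.
  apply (lsum_bij _ _ (fun '(p, r) => (r, p)) (fun '(p, r) => (r, p)));
    try apply NoDup_quads;
    intros [[a x] [b y]]; rewrite in_quads; rewrite in_quads; repeat split; lia.
Qed.

Lemma qsum_dual n f : qsum n (fun a x b y => f x a y b) = qsum n f.
Proof.
  apply (lsum_bij _ _ (fun '((a, x), (b, y)) => ((x, a), (y, b)))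
           (fun '((a, x), (b, y)) => ((x, a), (y, b))));
    try apply NoDup_quads;
    intros [[a x] [b y]]; rewrite in_quads; rewrite in_quads; repeat split; lia.
Qed.

(** Subtracting the shorter column from the longer one: since
    [a x + b y = a (x - y) + (a + b) y], the map
    [(a, x, b, y) -> (a, x - y, a + b, y)] sends the solutions with [y < x]
    bijectively to those with [a < b]. *)
Lemma qsum_transfer n f :
  qsum n (fun a x b y => if (y <? x)%nat then f a x b y else 0)
  = qsum n (fun a x b y => if (a <? b)%nat then f a (x + y)%nat (b - a)%nat y else 0).
Proof.
  set (u := fun t : (nat * nat) * (nat * nat) => let '((a, x), (b, y)) := t in f a x b y).
  transitivity (lsum (quads n) (fun t =>
    if (let '((a, x), (b, y)) := t in (y <? x)%nat) then u t else 0)).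
  { apply lsum_ext; intros [[a x] [b y]] _; reflexivity. }
  transitivity (lsum (quads n) (fun t =>
    if (let '((a, x), (b, y)) := t in (a <? b)%nat)
    then u (let '((a, x), (b, y)) := t in ((a, x + y), (b - a, y))%nat) else 0)).
  2:{ apply lsum_ext; intros [[a x] [b y]] _; reflexivity. }
  apply (lsum_reindex _ _ _ _
           (fun '((a, x), (b, y)) => ((a, x - y), (a + b, y))%nat)
           (fun '((a, x), (b, y)) => ((a, x + y), (b - a, y))%nat));
    try apply NoDup_quads; intros [[a x] [b y]]; rewrite !in_quads, !Nat.ltb_lt;
    intros H1 H2; cbv beta iota.
  - replace (a + b - a)%nat with b by lia.
    replace (x - y + y)%nat with x by lia.
    repeat split; nia.
  - replace (a + (b - a))%nat with b by lia.
    replace (x + y - y)%nat with x by lia.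
    repeat split; nia.
Qed.

(** On the diagonal [x = y] the equation reads [(a + b) x = n], so [a + b] is a
    divisor [d] and [a] is any number from [1] to [d - 1]. *)
Lemma qsum_diag n f :
  qsum n (fun a x b y => if (x =? y)%nat then f a x b y else 0)
  = dsum n (fun d e => lsum (seq 1 (d - 1)) (fun l => f l e (d - l)%nat e)).
Proof.
  unfold dsum.
  transitivity (lsum (dep_pairs (factorizations n) (fun p => seq 1 (fst p - 1)))
    (fun '(p, l) => let '(d, e) := p in f l e (d - l)%nat e)).
  2:{ etransitivity;
        [apply (lsum_dep_pairs _ _
                  (fun p l => let '(d, e) := p in f l e (d - l)%nat e))|].
      apply lsum_ext; intros [d e] _; reflexivity. }
  transitivity (lsum (quads n) (fun t =>
    if (let '((a, x), (b, y)) := t in (x =? y)%nat) then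
      (let '((a, x), (b, y)) := t in f a x b y) else 0)).
  { apply lsum_ext; intros [[a x] [b y]] _; reflexivity. }
  etransitivity.
  - apply (lsum_reindex _ (dep_pairs (factorizations n) (fun p => seq 1 (fst p - 1)))
     _ (fun _ => true) (fun '((a, x), (b, y)) => ((a + b, x), a)%nat)
     (fun '((d, e), l) => ((l, e), (d - l, e))%nat)
     _ (fun '((d, e), l) => f l e (d - l)%nat e)).
    + apply NoDup_quads.
    + apply NoDup_dep_pairs; [apply NoDup_factorizations|intros; apply seq_NoDup].
    + intros [[a x] [b y]]; rewrite in_quads, Nat.eqb_eq; intros H ->.
      rewrite in_dep_pairs, in_factorizations, in_seq; cbn [fst].
      replace (a + b - a)%nat with b by lia.
      repeat split; nia.
    + intros [[d e] l]; rewrite in_dep_pairs, in_factorizations, in_seq; cbn [fst].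
      intros H _; rewrite in_quads, Nat.eqb_refl.
      replace (l + (d - l))%nat with d by lia.
      repeat split; nia.
  - apply lsum_ext; intros [[d e] l] _; reflexivity.
Qed.

(** For [a > b] the transfer lemma (with the roles of [a], [b] and [x], [y] exchanged)
    replaces [a - b] by a free unknown, so the terms [F(|a-b|)] with distinct [a], [b]
    become twice the sum of [F(a)] over the solutions with [x < y]; similarly the
    terms [F(a+b)] with distinct [x], [y] become twice the sum of [F(a)] over the
    solutions with [b < a].  These two sums differ only by
    diagonal terms: the sum of [F(a)] over all solutions can be split by the order of
    [a] and [b] or by the order of [x] and [y], and the transfer lemma identifies the
    parts [a < b] and [y < x]. *)
Theorem liouville (F : nat -> Z) n :
  qsum n (fun a x b y => F ((a - b) + (b - a))%nat - F (a + b)%nat)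
  = dsum n (fun d e => (Z.of_nat e - 1) * (F 0%nat + 2 * F d)
                       - (Z.of_nat d - 1) * F d - 2 * lsum (seq 1 (d - 1)) F).
Proof.
  set (Sab := qsum n (fun a x b y => if (b <? a)%nat then F a else 0)).
  set (Sba := qsum n (fun a x b y => if (a <? b)%nat then F a else 0)).
  set (Sxy := qsum n (fun a x b y => if (y <? x)%nat then F a else 0)).
  set (Syx := qsum n (fun a x b y => if (x <? y)%nat then F a else 0)).
  (* A summand that does not depend on the position on a diagonal is counted
     [d - 1] times. *)
  assert (dcard : forall f : nat -> nat -> Z,
    dsum n (fun d e => lsum (seq 1 (d - 1)) (fun _ => f d e))
    = dsum n (fun d e => (Z.of_nat d - 1) * f d e)).
  { intros f; apply dsum_ext; intros d e Hd _ _.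
    rewrite lsum_const, length_seq, Nat2Z.inj_sub by lia; reflexivity. }
  assert (E1 : Sxy = Sba) by apply (qsum_transfer n (fun a _ _ _ => F a)).
  assert (E2 : Sab + qsum n (fun a x b y => if (a =? b)%nat then F a else 0) + Sba
             = Syx + qsum n (fun a x b y => if (x =? y)%nat then F a else 0) + Sxy).
  { unfold Sab, Sba, Sxy, Syx; rewrite <- !qsum_add; apply qsum_ext; intros a x b y _ _ _ _ _.
    destruct (Nat.ltb_spec b a), (Nat.ltb_spec a b), (Nat.eqb_spec a b),
      (Nat.ltb_spec x y), (Nat.ltb_spec y x), (Nat.eqb_spec x y); lia. }
  assert (E3 : qsum n (fun a x b y => if (a =? b)%nat then F a else 0)
             = dsum n (fun d e => (Z.of_nat e - 1) * F d)).
  { rewrite <- (qsum_dual n), (qsum_diag n (fun a x _ _ => F x)).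
    rewrite (dcard (fun _ e => F e)).
    apply (dsum_flip n (fun d e => (Z.of_nat e - 1) * F d)). }
  assert (E4 : qsum n (fun a x b y => if (x =? y)%nat then F a else 0)
             = dsum n (fun d e => lsum (seq 1 (d - 1)) F)).
  { rewrite (qsum_diag n (fun a _ _ _ => F a)); reflexivity. }
  assert (E5 : qsum n (fun a x b y => F ((a - b) + (b - a))%nat)
             = dsum n (fun d e => (Z.of_nat e - 1) * F 0%nat) + 2 * Syx).
  { transitivity (qsum n (fun a x b y => if (a =? b)%nat then F 0%nat else 0)
      + qsum n (fun a x b y => if (b <? a)%nat then F (a - b)%nat else 0)
      + qsum n (fun a x b y => if (a <? b)%nat then F (b - a)%nat else 0)).
    { rewrite <- !qsum_add; apply qsum_ext; intros a x b y _ _ _ _ _.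
      destruct (Nat.ltb_spec b a), (Nat.ltb_spec a b), (Nat.eqb_spec a b); try lia.
      - replace (a - b + (b - a))%nat with (a - b)%nat by lia; lia.
      - replace (a - b + (b - a))%nat with (b - a)%nat by lia; lia.
      - replace (a - b + (b - a))%nat with 0%nat by lia; lia. }
    rewrite <- (qsum_swap n (fun a x b y => if (b <? a)%nat then F (a - b)%nat else 0)).
    rewrite <- (qsum_transfer n (fun _ _ b _ => F b)).
    rewrite <- (qsum_swap n (fun a x b y => if (y <? x)%nat then F b else 0)).
    fold Syx.
    rewrite <- (qsum_dual n (fun a x b y => if (a =? b)%nat then _ else 0)).
    rewrite (qsum_diag n (fun a x _ _ => F 0%nat)), (dcard (fun _ _ => F 0%nat)).
    rewrite (dsum_flip n (fun d e => (Z.of_nat e - 1) * F 0%nat)); ring. }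
  assert (E6 : qsum n (fun a x b y => F (a + b)%nat)
             = dsum n (fun d e => (Z.of_nat d - 1) * F d) + 2 * Sab).
  { transitivity (qsum n (fun a x b y => if (x =? y)%nat then F (a + b)%nat else 0)
      + qsum n (fun a x b y => if (x <? y)%nat then F (a + b)%nat else 0)
      + qsum n (fun a x b y => if (y <? x)%nat then F (a + b)%nat else 0)).
    { rewrite <- !qsum_add; apply qsum_ext; intros a x b y _ _ _ _ _.
      destruct (Nat.ltb_spec x y), (Nat.ltb_spec y x), (Nat.eqb_spec x y); lia. }
    rewrite <- (qsum_swap n (fun a x b y => if (x <? y)%nat then F (a + b)%nat else 0)).
    rewrite (qsum_transfer n (fun a _ b _ => F (b + a)%nat)).
    rewrite (qsum_transfer n (fun a _ b _ => F (a + b)%nat)).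
    rewrite (qsum_ext n (fun a x b y => if (a <? b)%nat then F (b - a + a)%nat else 0)
               (fun a x b y => if (a <? b)%nat then F b else 0)).
    2:{ intros a x b y _ _ _ _ _; destruct (Nat.ltb_spec a b); [f_equal; lia|reflexivity]. }
    rewrite (qsum_ext n (fun a x b y => if (a <? b)%nat then F (a + (b - a))%nat else 0)
               (fun a x b y => if (a <? b)%nat then F b else 0)).
    2:{ intros a x b y _ _ _ _ _; destruct (Nat.ltb_spec a b); [f_equal; lia|reflexivity]. }
    rewrite (qsum_swap n (fun a x b y => if (b <? a)%nat then F a else 0)).
    fold Sab.
    rewrite (qsum_diag n (fun a _ b _ => F (a + b)%nat)).
    rewrite <- (dcard (fun d _ => F d)).
    rewrite (dsum_ext n (fun d e => lsum (seq 1 (d - 1)) (fun l => F (l + (d - l))%nat))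
               (fun d e => lsum (seq 1 (d - 1)) (fun _ => F d))).
    2:{ intros d e _ _ _; apply lsum_ext; intros l Hl; apply in_seq in Hl; f_equal; lia. }
    ring. }
  rewrite qsum_sub, E5, E6, !dsum_sub, dsum_scal.
  rewrite (dsum_ext n (fun d e => (Z.of_nat e - 1) * (F 0%nat + 2 * F d))
             (fun d e => (Z.of_nat e - 1) * F 0%nat + 2 * ((Z.of_nat e - 1) * F d)))
    by (intros; ring).
  rewrite dsum_add, dsum_scal, <- E3, <- E4.
  lia.
Qed.

(** * Divisor functions and their parity decompositions *)

Definition sigma (s n : nat) : Z := dsum n (fun d _ => Z.of_nat d ^ Z.of_nat s).

(** The sequence [n -> u (n / 2)], with value [z] when [n / 2] is not an integer.
    On coefficients it is the substitution of [q ^ 2] for [q]. *)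
Definition spread {A : Type} (z : A) (u : nat -> A) (n : nat) : A :=
  if Nat.even n then u (Nat.div2 n) else z.

Lemma spread_double {A : Type} (z : A) u m : spread z u (2 * m) = u m.
Proof. unfold spread; rewrite Nat.even_even, Nat.div2_double; reflexivity. Qed.

Lemma spread_succ_double {A : Type} (z : A) u m : spread z u (2 * m + 1) = z.
Proof. unfold spread; rewrite Nat.even_odd; reflexivity. Qed.

(** The factorizations [d * e = n] with [d = 2 d'] are those of [n / 2]. *)
Lemma dsum_even_part n f :
  dsum n (fun d e => if Nat.even d then f d e else 0)
  = spread 0 (fun m => dsum m (fun d e => f (2 * d)%nat e)) n.
Proof.
  destruct (Nat.Even_or_Odd n) as [[m ->] | [m ->]].
  - rewrite spread_double; symmetry; unfold dsum.
    transitivity (lsum (factorizations (2 * m)) (fun p =>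
      if Nat.even (fst p) then (let '(d, e) := p in f d e) else 0)).
    2:{ apply lsum_ext; intros [d e] _; reflexivity. }
    apply (lsum_reindex _ _ (fun _ => true) _ (fun '(d, e) => (2 * d, e)%nat)
             (fun '(d, e) => (Nat.div2 d, e))); try apply NoDup_factorizations.
    + intros [d e] H _; cbn [fst]; rewrite in_factorizations in *.
      rewrite Nat.even_even, Nat.div2_double; repeat split; nia.
    + intros [d e] H Hd; cbn [fst] in Hd; rewrite in_factorizations in *.
      apply Nat.even_spec in Hd; destruct Hd as [k ->].
      rewrite Nat.div2_double; repeat split; nia.
  - rewrite spread_succ_double.
    rewrite (dsum_ext _ _ (fun _ _ => 0 * 0)).
    + rewrite dsum_scal; reflexivity.
    + intros d e _ _ E; destruct (Nat.even d) eqn:Hd; [|reflexivity].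
      apply Nat.even_spec in Hd; destruct Hd as [k ->]; nia.
Qed.

Lemma dsum_even_part_conj n f :
  dsum n (fun d e => if Nat.even e then f d e else 0)
  = spread 0 (fun m => dsum m (fun d e => f d (2 * e)%nat)) n.
Proof.
  rewrite <- dsum_flip.
  rewrite (dsum_even_part n (fun d e => f e d)).
  unfold spread; destruct (Nat.even n); [|reflexivity].
  apply (dsum_flip _ (fun d e => f d (2 * e)%nat)).
Qed.

Lemma spread_ext {A : Type} (z : A) u v n :
  (forall m, u m = v m) -> spread z u n = spread z v n.
Proof. intros H; unfold spread; rewrite H; reflexivity. Qed.

Lemma spread_scal c u n : spread 0 (fun m => c * u m) n = c * spread 0 u n.
Proof. unfold spread; destruct (Nat.even n); ring. Qed.

Lemma sigma_even_part s n :
  dsum n (fun d _ => if Nat.even d then Z.of_nat d ^ Z.of_nat s else 0)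
  = 2 ^ Z.of_nat s * spread 0 (sigma s) n.
Proof.
  rewrite dsum_even_part, <- spread_scal; apply spread_ext; intros m.
  unfold sigma; rewrite <- dsum_scal; apply dsum_ext; intros d e _ _ _.
  rewrite Nat2Z.inj_mul, Z.pow_mul_l; reflexivity.
Qed.

Lemma neg_one_pow_pred d :
  (1 <= d)%nat -> (-1) ^ Z.of_nat (d - 1) = if Nat.even d then -1 else 1.
Proof.
  intros Hd; destruct (Nat.Even_or_Odd d) as [[m ->] | [m ->]].
  - rewrite Nat.even_even, Nat2Z.inj_sub, Nat2Z.inj_mul by lia.
    replace (Z.of_nat 2 * Z.of_nat m - Z.of_nat 1) with (2 * (Z.of_nat m - 1) + 1) by lia.
    rewrite Z.pow_add_r, Z.pow_mul_r by lia.
    change ((-1) ^ 2) with 1; rewrite Z.pow_1_l by lia; reflexivity.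
  - rewrite Nat.even_odd.
    replace (Z.of_nat (2 * m + 1 - 1)) with (2 * Z.of_nat m) by lia.
    rewrite Z.pow_mul_r by lia.
    change ((-1) ^ 2) with 1; rewrite Z.pow_1_l by lia; reflexivity.
Qed.

Lemma sigma_tilde_sigma s n :
  sigma_tilde s n = sigma s n - 2 ^ Z.of_nat (S s) * spread 0 (sigma s) n.
Proof.
  transitivity (dsum n (fun d _ => (-1) ^ Z.of_nat (d - 1) * Z.of_nat d ^ Z.of_nat s)).
  { symmetry; apply dsum_divisors. }
  rewrite Nat2Z.inj_succ, Z.pow_succ_r by lia.
  rewrite <- Z.mul_assoc, <- sigma_even_part, <- dsum_scal.
  unfold sigma; rewrite <- dsum_sub; apply dsum_ext; intros d e Hd _ _.
  rewrite neg_one_pow_pred by assumption; destruct (Nat.even d); lia.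
Qed.

Lemma sigma_hat_sigma s n :
  sigma_hat s n = sigma s n - 2 * spread 0 (sigma s) n.
Proof.
  transitivity (dsum n (fun d e => (-1) ^ Z.of_nat (e - 1) * Z.of_nat d ^ Z.of_nat s)).
  { symmetry.
    apply (dsum_divisors n (fun d e => (-1) ^ Z.of_nat (e - 1) * Z.of_nat d ^ Z.of_nat s)). }
  unfold sigma at 2; rewrite <- (dsum_even_part_conj n (fun d _ => Z.of_nat d ^ Z.of_nat s)).
  rewrite <- dsum_scal; unfold sigma; rewrite <- dsum_sub.
  apply dsum_ext; intros d e _ He _.
  rewrite neg_one_pow_pred by assumption; destruct (Nat.even e); lia.
Qed.

(** Among the divisors of [2 m], the even ones are the doubles of the divisors of
    [m]; the odd ones are the odd divisors of [m], whose sum is found by removing the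
    even ones again. *)
Lemma sigma_double s m :
  sigma s (2 * m)
  = (1 + 2 ^ Z.of_nat s) * sigma s m - 2 ^ Z.of_nat s * spread 0 (sigma s) m.
Proof.
  set (odd_part := fun n =>
    dsum n (fun d _ => if Nat.even d then 0 else Z.of_nat d ^ Z.of_nat s)).
  assert (split : forall n,
    sigma s n = odd_part n + 2 ^ Z.of_nat s * spread 0 (sigma s) n).
  { intros n; rewrite <- sigma_even_part; unfold sigma, odd_part; rewrite <- dsum_add.
    apply dsum_ext; intros d e _ _ _; destruct (Nat.even d); lia. }
  (* An odd divisor of [2 * m] has an even cofactor, so it comes from a factorization
     of [m]. *)
  assert (H : odd_part (2 * m)%nat = odd_part m).
  { unfold odd_part.
    rewrite <- (spread_double 0 (fun m => dsum m _) m).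
    rewrite <- (dsum_even_part_conj _ (fun d _ => if Nat.even d then 0 else _)).
    apply dsum_ext; intros d e _ _ E.
    destruct (Nat.even d) eqn:Hd; [destruct (Nat.even e); reflexivity|].
    replace (Nat.even e) with true; [reflexivity|].
    symmetry; assert (E2 : Nat.even (d * e) = true) by (rewrite E; apply Nat.even_even).
    rewrite Nat.even_mul, Hd in E2; exact E2. }
  assert (E2m := split (2 * m)%nat); assert (Em := split m).
  rewrite H, spread_double in E2m; lia.
Qed.

(** The coefficients of the power series at [-q]: the even part of [sigma] is
    expressed by [sigma_double], and the odd part is the rest. *)
Lemma sigma_alternating s n :
  (if Nat.even n then sigma s n else - sigma s n)
  = - sigma s n + 2 * (1 + 2 ^ Z.of_nat s) * spread 0 (sigma s) n
    - 2 * 2 ^ Z.of_nat s * spread 0 (spread 0 (sigma s)) n.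
Proof.
  destruct (Nat.Even_or_Odd n) as [[m ->] | [m ->]].
  - rewrite Nat.even_even, !spread_double, sigma_double; ring.
  - rewrite Nat.even_odd, !spread_succ_double; ring.
Qed.

(** * Convolution sums *)

Definition conv (u v : nat -> Z) (n : nat) : Z :=
  lsum (seq 0 (S n)) (fun k => u k * v (n - k)%nat).

Lemma lsum_seq_S m f : lsum (seq 1 (S m)) f = lsum (seq 1 m) f + f (S m).
Proof. rewrite seq_S, lsum_app, lsum_cons; unfold lsum; simpl; ring. Qed.

Lemma lsum_squares m :
  let d := Z.of_nat m + 1 in
  6 * lsum (seq 1 m) (fun l => Z.of_nat l ^ 2) = (d - 1) * d * (2 * d - 1).
Proof.
  cbv zeta; induction m as [|m IH]; [reflexivity|].
  rewrite lsum_seq_S, Z.mul_add_distr_l, IH, Nat2Z.inj_succ; ring.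
Qed.

Lemma lsum_even_squares m :
  let d := Z.of_nat m + 1 in
  6 * lsum (seq 1 m) (fun l => if Nat.even l then Z.of_nat l ^ 2 else 0)
  = if Nat.even m then d ^ 3 - d else d ^ 3 - 3 * d ^ 2 + 2 * d.
Proof.
  cbv zeta; induction m as [|m IH]; [reflexivity|].
  rewrite lsum_seq_S, Z.mul_add_distr_l, IH, Nat2Z.inj_succ.
  rewrite Nat.even_succ, <- Nat.negb_even; destruct (Nat.even m); simpl negb; cbv iota; ring.
Qed.

(** Liouville's identity for [F l = l ^ 2], where [F (|a-b|) - F (a+b)] is
    [-4 a b].  The right-hand sides agree divisor by divisor. *)
Lemma conv_sigma_sigma n :
  12 * conv (sigma 1) (sigma 1) n
  = 5 * sigma 3 n + sigma 1 n - 6 * (Z.of_nat n * sigma 1 n).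
Proof.
  assert (L := liouville (fun l => Z.of_nat l ^ 2) n).
  rewrite (qsum_ext n _ (fun a x b y => (-4) * (Z.of_nat a ^ 1 * Z.of_nat b ^ 1))) in L.
  2:{ intros a x b y _ _ _ _ _.
      destruct (Nat.le_ge_cases a b) as [H | H].
      - replace (a - b + (b - a))%nat with (b - a)%nat by lia.
        rewrite Nat2Z.inj_sub, Nat2Z.inj_add by assumption; ring.
      - replace (a - b + (b - a))%nat with (a - b)%nat by lia.
        rewrite Nat2Z.inj_sub, Nat2Z.inj_add by assumption; ring. }
  rewrite qsum_scal, qsum_conv in L.
  change (lsum (seq 0 _) _) with (conv (sigma 1) (sigma 1) n) in L.
  apply (f_equal (fun z => - 3 * z)) in L.
  replace (12 * conv (sigma 1) (sigma 1) n)
    with (- 3 * (-4 * conv (sigma 1) (sigma 1) n)) by ring.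
  rewrite L; unfold sigma.
  rewrite <- !dsum_scal, <- dsum_add, <- dsum_sub.
  apply dsum_ext; intros d e Hd He <-.
  assert (S := lsum_squares (d - 1)); cbv zeta in S.
  replace (Z.of_nat (d - 1) + 1) with (Z.of_nat d) in S by lia.
  rewrite Nat2Z.inj_mul; simpl (Z.of_nat 0); simpl (Z.of_nat 1); simpl (Z.of_nat 3).
  lia.
Qed.

Lemma conv_ext u u' v v' n :
  (forall k, u k = u' k) -> (forall k, v k = v' k) -> conv u v n = conv u' v' n.
Proof. intros Hu Hv; apply lsum_ext; intros k _; rewrite Hu, Hv; reflexivity. Qed.

Lemma conv_scal c u v n : conv (fun k => c * u k) (fun k => c * v k) n = c ^ 2 * conv u v n.
Proof. unfold conv; rewrite <- lsum_scal; apply lsum_ext; intros k _; ring. Qed.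

(** Liouville's identity for the squares of even numbers.  As [a - b] and [a + b]
    have the same parity, the summand is [-4 a b] when [a] and [b] have equal parity
    and [0] otherwise.  The sum of the odd divisors of [n] is
    [sigma_1(n) - 2 sigma_1(n/2) = sigma_hat_1(n)] and that of the even ones is
    [2 sigma_1(n/2)], which gives the two convolutions on the left. *)
Lemma conv_parity_sigma n :
  12 * (conv (sigma_hat 1) (sigma_hat 1) n
        + 4 * conv (spread 0 (sigma 1)) (spread 0 (sigma 1)) n)
  = sigma 3 n - sigma 1 n + 24 * spread 0 (sigma 3) n + 6 * spread 0 (sigma 1) n
    - 12 * (Z.of_nat n * spread 0 (sigma 1) n).
Proof.
  assert (Hodd : forall m, sigma_hat 1 m
            = dsum m (fun d _ => if Nat.even d then 0 else Z.of_nat d)).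
  { intros m; rewrite sigma_hat_sigma.
    change (2 * spread 0 (sigma 1) m) with (2 ^ Z.of_nat 1 * spread 0 (sigma 1) m).
    rewrite <- sigma_even_part; unfold sigma; rewrite <- dsum_sub.
    apply dsum_ext; intros d e _ _ _; simpl (Z.of_nat 1).
    rewrite Z.pow_1_r; destruct (Nat.even d); ring. }
  assert (Heven : forall m, 2 * spread 0 (sigma 1) m
            = dsum m (fun d _ => if Nat.even d then Z.of_nat d else 0)).
  { intros m.
    change (2 * spread 0 (sigma 1) m) with (2 ^ Z.of_nat 1 * spread 0 (sigma 1) m).
    rewrite <- sigma_even_part.
    apply dsum_ext; intros d e _ _ _; simpl (Z.of_nat 1); rewrite Z.pow_1_r; reflexivity. }
  change 4 with (2 ^ 2); rewrite <- conv_scal.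
  rewrite (conv_ext _ _ _ _ n Hodd Hodd), (conv_ext _ _ _ _ n Heven Heven).
  set (F := fun l => if Nat.even l then Z.of_nat l ^ 2 else 0).
  assert (L := liouville F n).
  rewrite (qsum_ext n _ (fun a x b y => (-4) *
     ((if Nat.even a then 0 else Z.of_nat a) * (if Nat.even b then 0 else Z.of_nat b)
      + (if Nat.even a then Z.of_nat a else 0) * (if Nat.even b then Z.of_nat b else 0)))) in L.
  2:{ intros a x b y _ _ _ _ _; unfold F.
      assert (E : Nat.even (a - b + (b - a)) = Nat.even (a + b)).
      { destruct (Nat.le_ge_cases a b) as [H | H].
        - replace (a + b)%nat with (a - b + (b - a) + 2 * a)%nat by lia.
          rewrite (Nat.even_add _ (2 * a)), Nat.even_even.
          destruct (Nat.even (a - b + (b - a))); reflexivity.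
        - replace (a + b)%nat with (a - b + (b - a) + 2 * b)%nat by lia.
          rewrite (Nat.even_add _ (2 * b)), Nat.even_even.
          destruct (Nat.even (a - b + (b - a))); reflexivity. }
      rewrite E, Nat.even_add.
      assert (D : Z.of_nat (a - b + (b - a)) ^ 2 - Z.of_nat (a + b) ^ 2
                  = -4 * (Z.of_nat a * Z.of_nat b)).
      { destruct (Nat.le_ge_cases a b) as [H | H].
        - replace (a - b + (b - a))%nat with (b - a)%nat by lia.
          rewrite Nat2Z.inj_sub, Nat2Z.inj_add by assumption; ring.
        - replace (a - b + (b - a))%nat with (a - b)%nat by lia.
          rewrite Nat2Z.inj_sub, Nat2Z.inj_add by assumption; ring. }
      destruct (Nat.even a), (Nat.even b); cbn [Bool.eqb]; lia. }
  rewrite qsum_scal, qsum_add, !qsum_conv in L.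
  unfold conv.
  apply (f_equal (fun z => - 3 * z)) in L.
  match type of L with - 3 * (-4 * ?x) = _ =>
    replace (12 * x) with (- 3 * (-4 * x)) by ring end.
  rewrite L; clear L.
  assert (E1 := sigma_even_part 1 n); assert (E3 := sigma_even_part 3 n).
  change (2 ^ Z.of_nat 1) with 2 in E1; change (2 ^ Z.of_nat 3) with 8 in E3.
  replace (24 * spread 0 (sigma 3) n) with (3 * (8 * spread 0 (sigma 3) n)) by ring.
  replace (6 * spread 0 (sigma 1) n) with (3 * (2 * spread 0 (sigma 1) n)) by ring.
  replace (12 * (Z.of_nat n * spread 0 (sigma 1) n))
    with (6 * Z.of_nat n * (2 * spread 0 (sigma 1) n)) by ring.
  rewrite <- E1, <- E3; unfold sigma.
  rewrite <- !dsum_scal, <- dsum_sub, <- !dsum_add, <- dsum_sub.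
  apply dsum_ext; intros d e Hd He <-.
  assert (S := lsum_even_squares (d - 1)); cbv zeta in S; fold F in S.
  replace (Z.of_nat (d - 1) + 1) with (Z.of_nat d) in S by lia.
  rewrite Nat2Z.inj_mul; unfold F at 1 2 3.
  simpl (Z.of_nat 0); simpl (Z.of_nat 1); simpl (Z.of_nat 3).
  rewrite Nat.even_sub in S by lia.
  simpl (Nat.even 1) in S; simpl (Nat.even 0); cbv iota.
  destruct (Nat.even d); cbn [Bool.eqb] in S; lia.
Qed.

(** There are at most [n] factorizations of [n]. *)
Lemma dsum_bound n s f :
  (forall d e, (1 <= d)%nat -> (1 <= e)%nat -> (d * e = n)%nat ->
     Z.abs (f d e) <= Z.of_nat n ^ Z.of_nat s) ->
  Z.abs (dsum n f) <= Z.of_nat n ^ Z.of_nat (S s).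
Proof.
  intros H.
  assert (G : forall l, (forall p, In p l -> In p (factorizations n)) ->
     Z.abs (lsum l (fun '(d, e) => f d e)) <= Z.of_nat (length l) * Z.of_nat n ^ Z.of_nat s).
  { induction l as [|[d e] l IH]; intros Hl; [reflexivity|].
    rewrite lsum_cons; cbn [length]; rewrite Nat2Z.inj_succ.
    assert (Hp := Hl (d, e) (or_introl eq_refl)); apply in_factorizations in Hp.
    assert (B := H d e ltac:(tauto) ltac:(tauto) ltac:(tauto)).
    assert (B' := IH (fun p Hp => Hl p (or_intror Hp))).
    lia. }
  specialize (G (factorizations n) (fun p Hp => Hp)).
  assert (Hlen : (length (factorizations n) <= n)%nat).
  { unfold factorizations, divisors; rewrite length_map.
    etransitivity; [apply filter_length_le|]; rewrite length_seq; lia. }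
  rewrite Nat2Z.inj_succ, Z.pow_succ_r by lia.
  unfold dsum.
  assert (0 <= Z.of_nat n ^ Z.of_nat s) by (apply Z.pow_nonneg; lia).
  nia.
Qed.

Local Close Scope Z_scope.

(** * Complex series *)

Definition has_sum (u : nat -> C) (l : C) : Prop :=
  @is_series C_AbsRing C_NormedModule u l.

Lemma has_sum_ext u v l : (forall n, u n = v n) -> has_sum u l -> has_sum v l.
Proof. intros H; apply is_series_ext; exact H. Qed.

Lemma has_sum_add u v l m :
  has_sum u l -> has_sum v m -> has_sum (fun n => u n + v n) (l + m).
Proof. intros Hu Hv; exact (is_series_plus _ _ _ _ Hu Hv). Qed.

Lemma has_sum_scal c u l : has_sum u l -> has_sum (fun n => c * u n) (c * l).
Proof. intros Hu; exact (is_series_scal c _ _ Hu). Qed.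

Lemma has_sum_unique u l m : has_sum u l -> has_sum u m -> l = m.
Proof. intros Hl Hm; rewrite <- (CSeries_unique _ _ Hl); apply CSeries_unique; exact Hm. Qed.

Lemma has_sum_subseq u v l (phi : nat -> nat) :
  filterlim phi eventually eventually ->
  (forall n, sum_n v n = sum_n u (phi n)) ->
  has_sum u l -> has_sum v l.
Proof.
  intros Hphi E Hu; unfold has_sum, is_series in *.
  apply filterlim_ext with (fun n => sum_n u (phi n)); [intros n; symmetry; apply E|].
  exact (filterlim_comp _ _ _ phi (sum_n u) _ _ _ Hphi Hu).
Qed.

Lemma sum_n_pairs (u : nat -> C) n :
  sum_n (fun m => u (2 * m)%nat + u (2 * m + 1)%nat) n = sum_n u (2 * n + 1).
Proof.
  induction n as [|n IH].
  - change (2 * 0 + 1)%nat with 1%nat; rewrite sum_Sn, !sum_O; reflexivity.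
  - replace (2 * S n + 1)%nat with (S (S (2 * n + 1))) by lia.
    rewrite !sum_Sn, IH.
    replace (2 * S n)%nat with (S (2 * n + 1)) by lia.
    replace (S (2 * n + 1) + 1)%nat with (S (S (2 * n + 1))) by lia.
    apply (@plus_assoc C_AbelianMonoid).
Qed.

Lemma has_sum_pairs u l :
  has_sum u l -> has_sum (fun m => u (2 * m)%nat + u (2 * m + 1)%nat) l.
Proof.
  apply has_sum_subseq with (fun n => 2 * n + 1)%nat.
  - intros P [N HN]; exists N; intros n Hn; apply HN; lia.
  - apply sum_n_pairs.
Qed.

Lemma sum_n_spread (u : nat -> C) n : sum_n (spread (RtoC 0) u) n = sum_n u (Nat.div2 n).
Proof.
  induction n as [|n IH]; [rewrite !sum_O; reflexivity|].
  rewrite sum_Sn, IH; clear IH.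
  destruct (Nat.Even_or_Odd n) as [[m ->] | [m ->]].
  - rewrite Nat.div2_double, Nat.div2_succ_double.
    replace (S (2 * m)) with (2 * m + 1)%nat by lia.
    rewrite spread_succ_double; apply (@plus_zero_r C_AbelianMonoid).
  - replace (S (2 * m + 1)) with (2 * S m)%nat by lia.
    rewrite spread_double, Nat.div2_double, sum_Sn.
    replace (2 * m + 1)%nat with (S (2 * m)) by lia.
    rewrite Nat.div2_succ_double; reflexivity.
Qed.

Lemma has_sum_spread u l : has_sum u l -> has_sum (spread (RtoC 0) u) l.
Proof.
  apply has_sum_subseq with Nat.div2; [|apply sum_n_spread].
  intros P [N HN]; exists (2 * N)%nat; intros n Hn; apply HN.
  rewrite Nat.div2_div; apply Nat.div_le_lower_bound; lia.
Qed.

Lemma fst_sum_n (u : nat -> C) n : fst (sum_n u n) = sum_n (fun k => fst (u k)) n.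
Proof. induction n as [|n IH]; [rewrite !sum_O|rewrite !sum_Sn, <- IH]; reflexivity. Qed.

Lemma snd_sum_n (u : nat -> C) n : snd (sum_n u n) = sum_n (fun k => snd (u k)) n.
Proof. induction n as [|n IH]; [rewrite !sum_O|rewrite !sum_Sn, <- IH]; reflexivity. Qed.

Lemma has_sum_components u l :
  has_sum u l <->
  is_series (fun n => fst (u n)) (fst l) /\ is_series (fun n => snd (u n)) (snd l).
Proof.
  unfold has_sum, is_series; split.
  - intros H; split.
    + apply filterlim_ext with (fun n => fst (sum_n u n)); [apply fst_sum_n|].
      apply (filterlim_comp _ _ _ _ fst _ (locally l)); [exact H|].
      intros P [eps HP]; exists eps; intros y Hy; apply HP; apply Hy.
    + apply filterlim_ext with (fun n => snd (sum_n u n)); [apply snd_sum_n|].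
      apply (filterlim_comp _ _ _ _ snd _ (locally l)); [exact H|].
      intros P [eps HP]; exists eps; intros y Hy; apply HP; apply Hy.
  - intros [H1 H2].
    apply filterlim_locally; intros eps.
    assert (G1 := proj1 (filterlim_locally _ _) H1 eps).
    assert (G2 := proj1 (filterlim_locally _ _) H2 eps).
    generalize (filter_and _ _ G1 G2); apply filter_imp; intros n [B1 B2].
    rewrite <- fst_sum_n in B1; rewrite <- snd_sum_n in B2.
    split; assumption.
Qed.

Lemma sum_f_R0_sub (f g : nat -> R) n :
  sum_f_R0 (fun k => (f k - g k)%R) n = (sum_f_R0 f n - sum_f_R0 g n)%R.
Proof. induction n as [|n IH]; simpl; [|rewrite IH]; lra. Qed.

Lemma sum_f_R0_add (f g : nat -> R) n :
  sum_f_R0 (fun k => (f k + g k)%R) n = (sum_f_R0 f n + sum_f_R0 g n)%R.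
Proof. induction n as [|n IH]; simpl; [|rewrite IH]; lra. Qed.

(** Cauchy product of absolutely convergent complex series, obtained from four
    products of real series by separating real and imaginary parts. *)
Lemma has_sum_mult u v l m :
  has_sum u l -> has_sum v m ->
  ex_series (fun n => Cmod (u n)) -> ex_series (fun n => Cmod (v n)) ->
  has_sum (fun n => sum_n (fun k => u k * v (n - k)%nat) n) (l * m).
Proof.
  intros Hu Hv Au Av.
  apply has_sum_components in Hu; destruct Hu as [Hu1 Hu2].
  apply has_sum_components in Hv; destruct Hv as [Hv1 Hv2].
  assert (comp : forall w : nat -> C, ex_series (fun n => Cmod (w n)) ->
    ex_series (fun n => Rabs (fst (w n))) /\ ex_series (fun n => Rabs (snd (w n)))).
  { intros w Hw; split;
      apply (ex_series_le (K := R_AbsRing) (V := R_CompleteNormedModule) _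
               (fun n => Cmod (w n)));
      try exact Hw; intros n; change norm with Rabs; rewrite Rabs_Rabsolu;
      eapply Rle_trans; [|apply Rmax_Cmod| |apply Rmax_Cmod]; [apply Rmax_l|apply Rmax_r]. }
  destruct (comp u Au) as [Au1 Au2]; destruct (comp v Av) as [Av1 Av2].
  assert (S11 := is_series_mult _ _ _ _ Hu1 Hv1 Au1 Av1).
  assert (S22 := is_series_mult _ _ _ _ Hu2 Hv2 Au2 Av2).
  assert (S12 := is_series_mult _ _ _ _ Hu1 Hv2 Au1 Av2).
  assert (S21 := is_series_mult _ _ _ _ Hu2 Hv1 Au2 Av1).
  apply has_sum_components; split.
  - eapply is_series_ext; [|exact (is_series_minus _ _ _ _ S11 S22)].
    intros n; rewrite fst_sum_n, sum_n_Reals; symmetry; apply sum_f_R0_sub.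
  - eapply is_series_ext; [|exact (is_series_plus _ _ _ _ S12 S21)].
    intros n; rewrite snd_sum_n, sum_n_Reals; symmetry; apply sum_f_R0_add.
Qed.

Lemma has_sum_Cmod_le u l (v : nat -> R) m :
  has_sum u l -> is_series v m -> (forall n, (Cmod (u n) <= v n)%R) -> (Cmod l <= m)%R.
Proof.
  intros Hu Hv Hle.
  assert (Hlim : is_lim_seq (fun n => Cmod (sum_n u n)) (Cmod l)).
  { exact (filterlim_comp _ _ _ _ _ _ _ _ Hu
             (@filterlim_norm C_AbsRing C_NormedModule l)). }
  refine (is_lim_seq_le (fun n => Cmod (sum_n u n)) (sum_n v) (Cmod l) m _ Hlim Hv).
  induction n as [|n IH]; [rewrite !sum_O; apply Hle|].
  rewrite !sum_Sn; eapply Rle_trans; [apply Cmod_triangle|].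
  apply Rplus_le_compat; [exact IH|apply Hle].
Qed.

(** * Integer sequences of polynomial growth *)

(** [(n + 1) r ^ n <= 1 + r + ... + r ^ n <= 1 / (1 - r)]. *)
Lemma succ_mul_pow_le r n : (0 <= r < 1)%R -> (INR (S n) * r ^ n <= / (1 - r))%R.
Proof.
  intros Hr.
  apply Rmult_le_reg_r with (1 - r)%R; [lra|].
  rewrite Rinv_l by lra.
  assert (G : (INR (S n) * r ^ n * (1 - r) <= 1 - r ^ S n)%R).
  { induction n as [|n IH]; [simpl; lra|].
    assert (Hn : (r ^ S n <= 1)%R) by (rewrite <- (pow1 (S n)); apply pow_incr; lra).
    rewrite (S_INR (S n)), <- (tech_pow_Rmult r (S n)).
    rewrite <- tech_pow_Rmult in *.
    assert (r * (INR (S n) * r ^ n * (1 - r)) <= r * (1 - r * r ^ n))%R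
      by (apply Rmult_le_compat_l; lra).
    assert (0 <= (1 - r) * (1 - r * r ^ n))%R by (apply Rmult_le_pos; lra).
    lra. }
  assert (0 <= r ^ S n)%R by (apply pow_le; lra); lra.
Qed.

(** Writing [r = t * t] leaves one geometric factor [t ^ n] to absorb each further
    power of [n + 1]. *)
Lemma poly_mul_geom_bounded k r :
  (0 <= r < 1)%R -> exists B, forall n, (INR (S n) ^ k * r ^ n <= B)%R.
Proof.
  revert r; induction k as [|k IH]; intros r Hr.
  - exists 1%R; intros n; simpl; rewrite Rmult_1_l.
    rewrite <- (pow1 n); apply pow_incr; lra.
  - set (t := sqrt r).
    assert (Ht : (0 <= t < 1)%R).
    { split; [apply sqrt_pos|]; rewrite <- sqrt_1; apply sqrt_lt_1; lra. }
    assert (Et : (t * t = r)%R) by (apply sqrt_sqrt; lra).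
    destruct (IH t Ht) as [B HB]; exists (B * / (1 - t))%R; intros n.
    rewrite <- Et, Rpow_mult_distr, <- tech_pow_Rmult.
    replace (INR (S n) * INR (S n) ^ k * (t ^ n * t ^ n))%R
      with ((INR (S n) ^ k * t ^ n) * (INR (S n) * t ^ n))%R by ring.
    assert (0 <= t ^ n)%R by (apply pow_le; lra).
    assert (0 <= INR (S n))%R by apply pos_INR.
    apply Rmult_le_compat; try apply HB; try (apply succ_mul_pow_le; assumption).
    + apply Rmult_le_pos; [apply pow_le|]; assumption.
    + apply Rmult_le_pos; assumption.
Qed.

Lemma ex_series_poly_mul_geom k r :
  (0 <= r < 1)%R -> ex_series (fun n => (INR (S n) ^ k * r ^ n)%R).
Proof.
  intros Hr.
  set (t := sqrt r).
  assert (Ht : (0 <= t < 1)%R).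
  { split; [apply sqrt_pos|]; rewrite <- sqrt_1; apply sqrt_lt_1; lra. }
  assert (Et : (t * t = r)%R) by (apply sqrt_sqrt; lra).
  destruct (poly_mul_geom_bounded k t Ht) as [B HB].
  apply (ex_series_le (K := R_AbsRing) (V := R_CompleteNormedModule) _ (fun n => (B * t ^ n)%R)).
  - intros n; change norm with Rabs.
    assert (0 <= t ^ n)%R by (apply pow_le; lra).
    assert (0 <= INR (S n) ^ k)%R by (apply pow_le, pos_INR).
    rewrite <- Et, Rpow_mult_distr, Rabs_pos_eq by
      (repeat apply Rmult_le_pos; assumption).
    rewrite <- Rmult_assoc; apply Rmult_le_compat_r; [assumption|apply HB].
  - apply (ex_series_scal (K := R_AbsRing) (V := R_NormedModule) B), ex_series_geom.
    rewrite Rabs_pos_eq; lra.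
Qed.

(** Polynomial growth with unspecified constant and exponent: this is stable under
    linear combinations, under the operator [q d/dq] and under the substitution of
    [q ^ 2], and it ensures absolute convergence on the whole unit disc. *)
Definition tempered (a : nat -> Z) : Prop :=
  exists (M : R) (k : nat), forall n, (Rabs (IZR (a n)) <= M * INR (S n) ^ k)%R.

Lemma pow_succ_ge1 n k : (1 <= INR (S n) ^ k)%R.
Proof. apply pow_R1_Rle; rewrite S_INR; generalize (pos_INR n); lra. Qed.

Lemma tempered_add a b : tempered a -> tempered b -> tempered (fun n => (a n + b n)%Z).
Proof.
  intros [M [k Ha]] [N [l Hb]]; exists (Rabs M + Rabs N)%R, (k + l)%nat; intros n.
  rewrite plus_IZR; eapply Rle_trans; [apply Rabs_triang|].
  specialize (Ha n); specialize (Hb n).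
  assert (Hk := pow_succ_ge1 n k); assert (Hl := pow_succ_ge1 n l).
  rewrite pow_add.
  assert (M <= Rabs M)%R by apply Rle_abs; assert (N <= Rabs N)%R by apply Rle_abs.
  assert (0 <= Rabs M)%R by apply Rabs_pos; assert (0 <= Rabs N)%R by apply Rabs_pos.
  set (x := (INR (S n) ^ k)%R) in *; set (y := (INR (S n) ^ l)%R) in *.
  assert (M * x <= Rabs M * (x * y))%R.
  { apply Rle_trans with (Rabs M * x)%R; [apply Rmult_le_compat_r; lra|].
    apply Rmult_le_compat_l; [lra|nra]. }
  assert (N * y <= Rabs N * (x * y))%R.
  { apply Rle_trans with (Rabs N * y)%R; [apply Rmult_le_compat_r; lra|].
    apply Rmult_le_compat_l; [lra|nra]. }
  lra.
Qed.

Lemma tempered_scal c a : tempered a -> tempered (fun n => (c * a n)%Z).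
Proof.
  intros [M [k Ha]]; exists (Rabs (IZR c) * M)%R, k; intros n.
  rewrite mult_IZR, Rabs_mult, Rmult_assoc.
  apply Rmult_le_compat_l; [apply Rabs_pos|apply Ha].
Qed.

Lemma tempered_ext a b : (forall n, a n = b n) -> tempered a -> tempered b.
Proof. intros E [M [k H]]; exists M, k; intros n; rewrite <- E; apply H. Qed.

(** The action of the operator [q d/dq] on coefficients. *)
Definition theta (a : nat -> Z) (n : nat) : Z := (Z.of_nat n * a n)%Z.

Lemma tempered_theta a : tempered a -> tempered (theta a).
Proof.
  intros [M [k Ha]]; exists M, (S k); intros n; unfold theta.
  rewrite mult_IZR, Rabs_mult, <- INR_IZR_INZ, Rabs_pos_eq by apply pos_INR.
  specialize (Ha n); rewrite <- tech_pow_Rmult.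
  assert (0 <= Rabs (IZR (a n)))%R by apply Rabs_pos.
  assert (INR n <= INR (S n))%R by (rewrite S_INR; lra).
  replace (M * (INR (S n) * INR (S n) ^ k))%R with (INR (S n) * (M * INR (S n) ^ k))%R by ring.
  apply Rmult_le_compat; try assumption; apply pos_INR.
Qed.

Lemma tempered_spread a : tempered a -> tempered (spread 0%Z a).
Proof.
  intros [M [k Ha]]; exists M, k; intros n.
  assert (HM : (0 <= M)%R).
  { specialize (Ha 0%nat); simpl INR in Ha; rewrite pow1, Rmult_1_r in Ha.
    eapply Rle_trans; [apply Rabs_pos|exact Ha]. }
  destruct (Nat.Even_or_Odd n) as [[m ->] | [m ->]].
  - rewrite spread_double; eapply Rle_trans; [apply Ha|].
    apply Rmult_le_compat_l; [exact HM|].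
    apply pow_incr; split; [apply pos_INR|apply le_INR; lia].
  - rewrite spread_succ_double, Rabs_R0.
    apply Rmult_le_pos; [exact HM|apply pow_le, pos_INR].
Qed.

Lemma tempered_sigma s : tempered (sigma s).
Proof.
  exists 1%R, (S s); intros n; rewrite Rmult_1_l.
  assert (B : (Z.abs (sigma s n) <= Z.of_nat n ^ Z.of_nat (S s))%Z).
  { apply dsum_bound; intros d e Hd He <-.
    rewrite Z.abs_eq by (apply Z.pow_nonneg; lia).
    apply Z.pow_le_mono_l; nia. }
  rewrite Rabs_Zabs; apply IZR_le in B.
  rewrite <- pow_IZR, <- INR_IZR_INZ in B.
  eapply Rle_trans; [exact B|].
  apply pow_incr; split; [apply pos_INR|apply le_INR; lia].
Qed.

(** * Power series with integer coefficients *)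

(** Identities between power series are proved by exhibiting one coefficient
    sequence with two sums, which avoids convergence conditions for sequences, such as
    convolutions, whose growth is never estimated. *)
Definition sums_to (a : nat -> Z) (q l : C) : Prop := has_sum (fun n => ZtoC (a n) * q ^ n) l.

Definition power_series (a : nat -> Z) (q : C) : C := CSeries (fun n => ZtoC (a n) * q ^ n).

Lemma Cmod_ZtoC z : Cmod (ZtoC z) = Rabs (IZR z).
Proof. apply Cmod_R. Qed.

Lemma ex_series_tempered a r k :
  tempered a -> (0 <= r < 1)%R ->
  ex_series (fun n => (INR (S n) ^ k * (Rabs (IZR (a n)) * r ^ n))%R).
Proof.
  intros [M [l Ha]] Hr.
  apply (ex_series_le (K := R_AbsRing) (V := R_CompleteNormedModule) _
           (fun n => (M * (INR (S n) ^ (k + l) * r ^ n))%R)).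
  - intros n; change norm with Rabs.
    assert (0 <= r ^ n)%R by (apply pow_le; lra).
    assert (0 <= INR (S n) ^ k)%R by (apply pow_le, pos_INR).
    assert (0 <= Rabs (IZR (a n)))%R by apply Rabs_pos.
    rewrite Rabs_pos_eq by (repeat apply Rmult_le_pos; assumption).
    rewrite pow_add.
    replace (M * (INR (S n) ^ k * INR (S n) ^ l * r ^ n))%R
      with (INR (S n) ^ k * ((M * INR (S n) ^ l) * r ^ n))%R by ring.
    apply Rmult_le_compat_l; [assumption|].
    apply Rmult_le_compat_r; [assumption|apply Ha].
  - apply (ex_series_scal (K := R_AbsRing) (V := R_NormedModule) M), ex_series_poly_mul_geom, Hr.
Qed.

Lemma ex_series_Cmod a q :
  tempered a -> (Cmod q < 1)%R -> ex_series (fun n => Cmod (ZtoC (a n) * q ^ n)).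
Proof.
  intros Ha Hq.
  eapply ex_series_ext; [|apply (ex_series_tempered a (Cmod q) 0 Ha)].
  - intros n; cbv beta; rewrite pow_O, Rmult_1_l, Cmod_mult, Cmod_ZtoC, Cmod_pow; reflexivity.
  - split; [apply Cmod_ge_0|exact Hq].
Qed.

Lemma has_sum_dominated u (v : nat -> R) :
  (forall n, (Cmod (u n) <= v n)%R) -> ex_series v -> exists l, has_sum u l.
Proof.
  intros H Hv.
  exact (ex_series_le (K := C_AbsRing) (V := C_CompleteNormedModule) u v H Hv).
Qed.

Lemma sums_to_power_series a q : tempered a -> (Cmod q < 1)%R -> sums_to a q (power_series a q).
Proof.
  intros Ha Hq.
  destruct (has_sum_dominated (fun n => ZtoC (a n) * q ^ n) _
              (fun n => Rle_refl _) (ex_series_Cmod a q Ha Hq)) as [l Hl].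
  unfold power_series; rewrite (CSeries_unique _ _ Hl); exact Hl.
Qed.

Lemma ZtoC_add x y : ZtoC (x + y) = ZtoC x + ZtoC y.
Proof. unfold ZtoC; rewrite plus_IZR, RtoC_plus; reflexivity. Qed.

Lemma ZtoC_mul x y : ZtoC (x * y) = ZtoC x * ZtoC y.
Proof. unfold ZtoC; rewrite mult_IZR, RtoC_mult; reflexivity. Qed.

Lemma ZtoC_opp x : ZtoC (- x) = - ZtoC x.
Proof. unfold ZtoC; rewrite opp_IZR, RtoC_opp; reflexivity. Qed.

Lemma sums_to_add a b q l m :
  sums_to a q l -> sums_to b q m -> sums_to (fun n => (a n + b n)%Z) q (l + m).
Proof.
  intros Ha Hb; eapply has_sum_ext; [|exact (has_sum_add _ _ _ _ Ha Hb)].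
  intros n; cbv beta; rewrite ZtoC_add; ring.
Qed.

Lemma sums_to_scal c a q l : sums_to a q l -> sums_to (fun n => (c * a n)%Z) q (ZtoC c * l).
Proof.
  intros Ha; eapply has_sum_ext; [|exact (has_sum_scal (ZtoC c) _ _ Ha)].
  intros n; cbv beta; rewrite ZtoC_mul; ring.
Qed.

Lemma sums_to_ext a b q l : (forall n, a n = b n) -> sums_to a q l -> sums_to b q l.
Proof. intros E; apply has_sum_ext; intros n; rewrite E; reflexivity. Qed.

Lemma sums_to_unique a b q l m :
  sums_to a q l -> sums_to b q m -> (forall n, a n = b n) -> l = m.
Proof.
  intros Ha Hb E; exact (has_sum_unique _ _ _ (sums_to_ext _ _ _ _ E Ha) Hb).
Qed.

Lemma Cmod_sq_lt1 q : (Cmod q < 1)%R -> (Cmod (q ^ 2) < 1)%R.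
Proof.
  intros Hq; rewrite Cmod_pow; assert (H := Cmod_ge_0 q); simpl; nra.
Qed.

Lemma sums_to_spread a q l : sums_to a (q ^ 2) l -> sums_to (spread 0%Z a) q l.
Proof.
  intros Ha; eapply has_sum_ext; [|exact (has_sum_spread _ _ Ha)].
  intros n; destruct (Nat.Even_or_Odd n) as [[m ->] | [m ->]].
  - rewrite !spread_double, Cpow_mult_r; reflexivity.
  - rewrite !spread_succ_double; unfold ZtoC; ring.
Qed.

Lemma Cpow_opp_even (q : C) m : (- q) ^ (2 * m) = q ^ (2 * m).
Proof. rewrite !Cpow_mult_r; f_equal; ring. Qed.

Lemma Cpow_opp_odd (q : C) m : (- q) ^ (2 * m + 1) = - q ^ (2 * m + 1).
Proof. rewrite !Cpow_add_r, Cpow_opp_even; ring. Qed.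

Lemma sums_to_opp a q l :
  sums_to a (- q) l -> sums_to (fun n => if Nat.even n then a n else (- a n)%Z) q l.
Proof.
  intros Ha; eapply has_sum_ext; [|exact Ha].
  intros n; cbv beta; destruct (Nat.Even_or_Odd n) as [[m ->] | [m ->]].
  - rewrite Nat.even_even, Cpow_opp_even; reflexivity.
  - rewrite Nat.even_odd, Cpow_opp_odd, ZtoC_opp; ring.
Qed.

Lemma CSeries_even a q l m : sums_to a q l -> sums_to a (- q) m ->
  CSeries (fun n => ZtoC (a (2 * n + 0)%nat) * q ^ (2 * n + 0)) = / 2 * (l + m).
Proof.
  intros Hl Hm; apply CSeries_unique.
  eapply has_sum_ext; [|exact (has_sum_scal (/ 2) _ _
    (has_sum_pairs _ _ (has_sum_add _ _ _ _ Hl Hm)))].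
  intros n; cbv beta; rewrite Nat.add_0_r, Cpow_opp_even, Cpow_opp_odd; field.
Qed.

Lemma CSeries_odd a q l m : sums_to a q l -> sums_to a (- q) m ->
  CSeries (fun n => ZtoC (a (2 * n + 1)%nat) * q ^ (2 * n + 1)) = / 2 * (l - m).
Proof.
  intros Hl Hm; apply CSeries_unique.
  replace (l - m) with (l + (- (1)) * m) by ring.
  eapply has_sum_ext; [|exact (has_sum_scal (/ 2) _ _
    (has_sum_pairs _ _ (has_sum_add _ _ _ _ Hl (has_sum_scal (- (1)) _ _ Hm))))].
  intros n; cbv beta; rewrite Cpow_opp_even, Cpow_opp_odd; field.
Qed.

Lemma CSeries_succ a q l : a 0%nat = 0%Z -> sums_to a q l ->
  CSeries (fun n => ZtoC (a (S n)) * q ^ S n) = l.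
Proof.
  intros H0 Ha; apply CSeries_unique.
  apply (is_series_incr_1 (V := C_NormedModule) (fun n => ZtoC (a n) * q ^ n)).
  rewrite H0.
  replace (plus _ _) with l; [exact Ha|].
  change (l = l + ZtoC 0 * q ^ 0); unfold ZtoC; ring.
Qed.

Lemma sum_n_ZtoC u v (q : C) n :
  sum_n (fun k => ZtoC (u k) * q ^ k * (ZtoC (v (n - k)%nat) * q ^ (n - k))) n
  = ZtoC (conv u v n) * q ^ n.
Proof.
  unfold conv.
  assert (G : forall m, (m <= n)%nat ->
    sum_n (fun k => ZtoC (u k) * q ^ k * (ZtoC (v (n - k)%nat) * q ^ (n - k))) m
    = ZtoC (lsum (seq 0 (S m)) (fun k => (u k * v (n - k)%nat)%Z)) * q ^ n).
  { assert (T : forall m, (m <= n)%nat ->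
      ZtoC (u m) * q ^ m * (ZtoC (v (n - m)%nat) * q ^ (n - m))
      = ZtoC (u m * v (n - m)%nat) * q ^ n).
    { intros m Hm; rewrite ZtoC_mul.
      replace (q ^ n) with (q ^ m * q ^ (n - m)); [ring|].
      rewrite <- Cpow_add_r; f_equal; lia. }
    induction m as [|m IH]; intros Hm.
    - rewrite sum_O, T by assumption; unfold lsum; simpl; rewrite Z.add_0_r; reflexivity.
    - rewrite sum_Sn, IH, T by lia.
      rewrite (seq_S (S m)), lsum_app, ZtoC_add, Nat.add_0_l.
      unfold lsum at 3; simpl map; simpl fold_right; rewrite Z.add_0_r.
      symmetry; apply Cmult_plus_distr_r. }
  apply G; lia.
Qed.

Lemma sums_to_conv a b q l m : tempered a -> tempered b -> (Cmod q < 1)%R ->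
  sums_to a q l -> sums_to b q m -> sums_to (conv a b) q (l * m).
Proof.
  intros Ha Hb Hq Hl Hm.
  eapply has_sum_ext; [intros n; apply sum_n_ZtoC|].
  exact (has_sum_mult _ _ _ _ Hl Hm (ex_series_Cmod a q Ha Hq) (ex_series_Cmod b q Hb Hq)).
Qed.

(** * Complex derivative of a power series *)

Lemma is_derive_of_quadratic (f : C -> C) (z l : C) (K delta : R) :
  (0 < delta)%R ->
  (forall w, (Cmod (w - z) < delta)%R ->
     (Cmod (f w - f z - (w - z) * l) <= K * Cmod (w - z) ^ 2)%R) ->
  @is_derive C_AbsRing C_NormedModule f z l.
Proof.
  intros Hdelta H; split; [apply (@is_linear_scal_l C_AbsRing C_NormedModule)|].
  intros x Hx.
  assert (E : z = x).
  { exact (@is_filter_lim_locally_unique C_AbsRing (AbsRing_NormedModule C_AbsRing) z x Hx). }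
  subst x; intros eps.
  assert (HK : (0 < Rabs K + 1)%R) by (generalize (Rabs_pos K); lra).
  assert (Hd : (0 < Rmin delta (eps / (Rabs K + 1)))%R).
  { apply Rmin_pos; [exact Hdelta|apply Rdiv_lt_0_compat; [apply cond_pos|exact HK]]. }
  apply (@locally_le_locally_norm C_AbsRing (AbsRing_NormedModule C_AbsRing)).
  exists (mkposreal _ Hd); intros w Hw.
  assert (Hw' : (Cmod (w - z) < Rmin delta (eps / (Rabs K + 1)))%R) by exact Hw.
  change (Cmod (f w - f z - (w - z) * l) <= eps * Cmod (w - z))%R.
  assert (Hw1 := Rlt_le_trans _ _ _ Hw' (Rmin_l _ _)).
  assert (Hw2 := Rlt_le_trans _ _ _ Hw' (Rmin_r _ _)).
  eapply Rle_trans; [apply H, Hw1|].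
  assert (H0 := Cmod_ge_0 (w - z)).
  simpl pow; rewrite Rmult_1_r, <- Rmult_assoc.
  apply Rmult_le_compat_r; [exact H0|].
  apply Rle_trans with ((Rabs K + 1) * Cmod (w - z))%R.
  - apply Rmult_le_compat_r; [exact H0|]; generalize (Rle_abs K); lra.
  - apply Rmult_le_reg_l with (/ (Rabs K + 1))%R; [apply Rinv_0_lt_compat, HK|].
    rewrite <- Rmult_assoc, Rinv_l, Rmult_1_l by lra.
    unfold Rdiv in Hw2; lra.
Qed.

(** The remainders [e_n = w^n - z^n - n z^(n-1) (w - z)] satisfy
    [e_(n+1) = w e_n + n z^(n-1) (w - z)^2], and the bound follows by induction.  The
    factor [r ^ 2] stands on the left so that the exponent [n - 2] does not occur. *)
Lemma power_remainder_bound r (z w : C) n :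
  (Cmod z <= r)%R -> (Cmod w <= r)%R ->
  (r ^ 2 * Cmod (w ^ n - z ^ n - (w - z) * (RtoC (INR n) * z ^ pred n))
   <= INR n ^ 2 * r ^ n * Cmod (w - z) ^ 2)%R.
Proof.
  intros Hz Hw.
  assert (Hr : (0 <= r)%R) by (eapply Rle_trans; [apply Cmod_ge_0|exact Hz]).
  induction n as [|n IH].
  { simpl INR; replace (w ^ 0 - z ^ 0 - (w - z) * (0 * z ^ pred 0)) with (RtoC 0)
      by (simpl; ring).
    rewrite Cmod_0; lra. }
  set (h := Cmod (w - z)) in *.
  assert (Hh : (0 <= h)%R) by apply Cmod_ge_0.
  set (d := RtoC (INR n) * z ^ pred n) in *.
  assert (Hd : d * z = RtoC (INR n) * z ^ n).
  { unfold d; destruct n; [simpl; ring|]; simpl pred; simpl Cpow; ring. }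
  assert (Bd : (r * Cmod d <= INR n * r ^ n)%R).
  { unfold d; rewrite Cmod_mult, Cmod_R, Rabs_pos_eq by apply pos_INR.
    destruct n as [|n]; [simpl; lra|].
    simpl pred; rewrite Cmod_pow, <- tech_pow_Rmult.
    assert (Cmod z ^ n <= r ^ n)%R by (apply pow_incr; split; [apply Cmod_ge_0|exact Hz]).
    replace (r * (INR (S n) * Cmod z ^ n))%R with (INR (S n) * (r * Cmod z ^ n))%R by ring.
    apply Rmult_le_compat_l; [apply pos_INR|]; apply Rmult_le_compat_l; assumption. }
  set (e := w ^ n - z ^ n - (w - z) * d) in *.
  replace (w ^ S n - z ^ S n - (w - z) * (RtoC (INR (S n)) * z ^ pred (S n)))
    with (w * e + d * (w - z) ^ 2).
  2:{ rewrite S_INR, RtoC_plus; simpl pred; unfold e.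
      transitivity (w * w ^ n - w * z ^ n - (w - z) * (d * z)); [ring|].
      rewrite Hd; simpl Cpow; ring. }
  apply Rle_trans with (r ^ 2 * (r * Cmod e + Cmod d * h ^ 2))%R.
  { apply Rmult_le_compat_l; [apply pow_le, Hr|].
    eapply Rle_trans; [apply Cmod_triangle|].
    rewrite !Cmod_mult, Cmod_pow; fold h.
    apply Rplus_le_compat_r, Rmult_le_compat_r; [apply Cmod_ge_0|exact Hw]. }
  assert (H1 : (r * (r ^ 2 * Cmod e) <= r * (INR n ^ 2 * r ^ n * h ^ 2))%R)
    by (apply Rmult_le_compat_l; assumption).
  assert (Hh2 : (0 <= h ^ 2)%R) by (apply pow_le, Hh).
  assert (H2 : (r * h ^ 2 * (r * Cmod d) <= r * h ^ 2 * (INR n * r ^ n))%R)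
    by (apply Rmult_le_compat_l; [apply Rmult_le_pos|]; assumption).
  rewrite S_INR, <- (tech_pow_Rmult r n).
  assert (H3 : (0 <= r * r ^ n * h ^ 2 * (INR n + 1))%R).
  { apply Rmult_le_pos; [apply Rmult_le_pos; [apply Rmult_le_pos|]|]; try assumption.
    - apply pow_le, Hr.
    - generalize (pos_INR n); lra. }
  lra.
Qed.

(** Term-by-term differentiation, on a disc of radius [r] strictly between [|q|]
    and [1]: the remainders are dominated by [n^2 |a_n| r^n |w - q|^2 / r^2], which is
    summable.  Only [q * l], the value of [q d/dq], is recorded. *)
Lemma is_derive_power_series a q : tempered a -> (Cmod q < 1)%R ->
  exists l, @is_derive C_AbsRing C_NormedModule (power_series a) q l
            /\ q * l = power_series (theta a) q.
Proof.
  intros Ha Hq.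
  set (r := ((1 + Cmod q) / 2)%R).
  assert (Hq0 := Cmod_ge_0 q).
  assert (Hr : (0 < r < 1)%R) by (unfold r; lra).
  assert (Hqr : (Cmod q < r)%R) by (unfold r; lra).
  set (t := fun n => ZtoC (a n) * (RtoC (INR n) * q ^ pred n)).
  assert (Dom : ex_series (fun n => (INR (S n) ^ 2 * (Rabs (IZR (a n)) * r ^ n))%R))
    by (apply ex_series_tempered; [exact Ha|lra]).
  assert (Ht : exists l, has_sum t l).
  { apply has_sum_dominated with
      (fun n => (/ r * (INR (S n) ^ 2 * (Rabs (IZR (a n)) * r ^ n)))%R).
    2:{ apply (ex_series_scal (K := R_AbsRing) (V := R_NormedModule) (/ r)%R), Dom. }
    intros n; unfold t.
    rewrite !Cmod_mult, Cmod_ZtoC, Cmod_R, Cmod_pow, (Rabs_pos_eq (INR n)) by apply pos_INR.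
    assert (P0 := Rabs_pos (IZR (a n))).
    assert (Hn := pos_INR n).
    assert (B : (INR n * Cmod q ^ pred n <= / r * (INR (S n) ^ 2 * r ^ n))%R).
    { destruct n as [|n].
      - simpl; rewrite Rmult_0_l; assert (0 < / r)%R by (apply Rinv_0_lt_compat; lra); lra.
      - simpl pred; rewrite <- (tech_pow_Rmult r n).
        replace (/ r * (INR (S (S n)) ^ 2 * (r * r ^ n)))%R
          with (INR (S (S n)) ^ 2 * r ^ n)%R by (field; lra).
        apply Rmult_le_compat; [exact Hn|apply pow_le, Hq0| |apply pow_incr; lra].
        rewrite (S_INR (S n)); nra. }
    replace (/ r * (INR (S n) ^ 2 * (Rabs (IZR (a n)) * r ^ n)))%R
      with (Rabs (IZR (a n)) * (/ r * (INR (S n) ^ 2 * r ^ n)))%R by ring.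
    apply Rmult_le_compat_l; assumption. }
  destruct Ht as [l Hl]; exists l; split.
  - destruct Dom as [S HS].
    apply is_derive_of_quadratic with (/ r ^ 2 * S)%R (r - Cmod q)%R; [lra|].
    intros w Hw.
    assert (Hwr : (Cmod w < r)%R).
    { replace w with (q + (w - q)) by ring.
      eapply Rle_lt_trans; [apply Cmod_triangle|lra]. }
    assert (Hw1 : (Cmod w < 1)%R) by lra.
    assert (Hsum : has_sum
      (fun n => ZtoC (a n) * (w ^ n - q ^ n - (w - q) * (RtoC (INR n) * q ^ pred n)))
      (power_series a w + (- (1)) * power_series a q + (- (w - q)) * l)).
    { eapply has_sum_ext; [|exact (has_sum_add _ _ _ _
        (has_sum_add _ _ _ _ (sums_to_power_series a w Ha Hw1)
           (has_sum_scal (- (1)) _ _ (sums_to_power_series a q Ha Hq)))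
        (has_sum_scal (- (w - q)) _ _ Hl))].
      intros n; unfold t; ring. }
    replace (power_series a w - power_series a q - (w - q) * l)
      with (power_series a w + (- (1)) * power_series a q + (- (w - q)) * l) by ring.
    apply (has_sum_Cmod_le _ _ (fun n =>
      ((/ r ^ 2 * Cmod (w - q) ^ 2) * (INR (Datatypes.S n) ^ 2 * (Rabs (IZR (a n)) * r ^ n)))%R)
      _ Hsum).
    + replace (/ r ^ 2 * S * Cmod (w - q) ^ 2)%R
        with (/ r ^ 2 * Cmod (w - q) ^ 2 * S)%R by ring.
      apply (is_series_scal (/ r ^ 2 * Cmod (w - q) ^ 2)%R _ _ HS).
    + intros n; rewrite Cmod_mult, Cmod_ZtoC.
      assert (B := power_remainder_bound r q w n (Rlt_le _ _ Hqr) (Rlt_le _ _ Hwr)).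
      assert (Hr2 : (0 < r ^ 2)%R) by (apply pow_lt; lra).
      replace (/ r ^ 2 * Cmod (w - q) ^ 2
                 * (INR (Datatypes.S n) ^ 2 * (Rabs (IZR (a n)) * r ^ n)))%R
        with (Rabs (IZR (a n)) * (/ r ^ 2 * (INR (Datatypes.S n) ^ 2 * r ^ n * Cmod (w - q) ^ 2)))%R
        by ring.
      apply Rmult_le_compat_l; [apply Rabs_pos|].
      apply Rmult_le_reg_l with (r ^ 2)%R; [exact Hr2|].
      rewrite <- (Rmult_assoc (r ^ 2) (/ r ^ 2)), Rinv_r, Rmult_1_l by lra.
      eapply Rle_trans; [exact B|].
      apply Rmult_le_compat_r; [apply pow_le, Cmod_ge_0|].
      apply Rmult_le_compat_r; [apply pow_le; lra|].
      apply pow_incr; split; [apply pos_INR|rewrite S_INR; lra].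
  - symmetry; apply CSeries_unique.
    eapply has_sum_ext; [|exact (has_sum_scal q _ _ Hl)].
    intros n; unfold t, theta; rewrite ZtoC_mul; unfold ZtoC at 2; rewrite <- INR_IZR_INZ.
    destruct n as [|n]; [simpl; ring|].
    simpl pred; simpl Cpow; ring.
Qed.

(** It is enough that [f] be given by the series inside the unit disc, since a
    derivative only depends on the values near [q]. *)
Lemma theta_affine (f : C -> C) (c k : C) a q :
  tempered a -> (Cmod q < 1)%R ->
  (forall z, (Cmod z < 1)%R -> f z = c + k * power_series a z) ->
  ex_C_derive f q /\ q * C_derive f q = k * power_series (theta a) q.
Proof.
  intros Ha Hq Hf.
  destruct (is_derive_power_series a q Ha Hq) as [l [Hl El]].
  assert (Hd : @is_derive C_AbsRing C_NormedModule f q (k * l)).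
  { apply (is_derive_ext_loc (fun z => c + k * power_series a z)).
    - apply (@locally_le_locally_norm C_AbsRing (AbsRing_NormedModule C_AbsRing)).
      assert (Hd : (0 < 1 - Cmod q)%R) by lra.
      exists (mkposreal _ Hd); intros w Hw.
      assert (Hw' : (Cmod (w - q) < 1 - Cmod q)%R) by exact Hw.
      symmetry; apply Hf.
      replace w with (q + (w - q)) by ring.
      eapply Rle_lt_trans; [apply Cmod_triangle|lra].
    - replace (k * l) with (0 + k * l) by ring.
      apply (@is_derive_plus C_AbsRing C_NormedModule (fun _ => c) (fun z => k * power_series a z)).
      + apply (@is_derive_const C_AbsRing C_NormedModule).
      + eapply filterdiff_ext_lin.
        * apply (@filterdiff_scal_r_fct C_AbsRing (AbsRing_NormedModule C_AbsRing)
                   C_NormedModule _ _ k (power_series a) _ Cmult_comm Hl).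
        * intros y; cbv beta.
          change (k * (y * l) = y * (k * l)); ring. }
  split; [exists (k * l); exact Hd|].
  rewrite (is_C_derive_unique _ _ _ Hd), <- El; ring.
Qed.

(** * Operations on power series *)

Lemma theta_spread a n : theta (spread 0%Z a) n = (2 * spread 0 (theta a) n)%Z.
Proof.
  unfold theta; destruct (Nat.Even_or_Odd n) as [[m ->] | [m ->]].
  - rewrite !spread_double; lia.
  - rewrite !spread_succ_double; lia.
Qed.

Lemma sums_to_spread_power_series a q : tempered a -> (Cmod q < 1)%R ->
  sums_to (spread 0%Z a) q (power_series a (q ^ 2)).
Proof.
  intros Ha Hq; apply sums_to_spread, sums_to_power_series;
    [exact Ha|apply Cmod_sq_lt1, Hq].
Qed.

Lemma power_series_theta_spread a q : tempered a -> (Cmod q < 1)%R ->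
  power_series (theta (spread 0%Z a)) q = 2 * power_series (theta a) (q ^ 2).
Proof.
  intros Ha Hq; assert (Hm := tempered_theta a Ha).
  exact (sums_to_unique _ _ _ _ _
    (sums_to_power_series _ q (tempered_theta _ (tempered_spread _ Ha)) Hq)
    (sums_to_scal 2 _ _ _ (sums_to_spread_power_series _ q Hm Hq)) (theta_spread a)).
Qed.

Lemma power_series_opp a x y q :
  tempered a -> (Cmod q < 1)%R ->
  (forall n, (if Nat.even n then a n else - a n)%Z
     = (-1 * a n + x * spread 0 a n + y * spread 0 (spread 0 a) n)%Z) ->
  power_series a (- q)
  = - power_series a q + ZtoC x * power_series a (q ^ 2)
    + ZtoC y * power_series a ((q ^ 2) ^ 2).
Proof.
  intros Ha Hq E.
  assert (Hq2 := Cmod_sq_lt1 q Hq).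
  assert (Hqn : (Cmod (- q) < 1)%R) by (rewrite Cmod_opp; exact Hq).
  rewrite (sums_to_unique _ _ _ _ _ (sums_to_opp _ _ _ (sums_to_power_series a (- q) Ha Hqn))
    (sums_to_add _ _ _ _ _
      (sums_to_add _ _ _ _ _ (sums_to_scal (-1) _ _ _ (sums_to_power_series a q Ha Hq))
        (sums_to_scal x _ _ _ (sums_to_spread_power_series a q Ha Hq)))
      (sums_to_scal y _ _ _ (sums_to_spread _ _ _ (sums_to_spread_power_series a _ Ha Hq2)))) E).
  unfold ZtoC at 1; ring.
Qed.

(** The following lemmas serve [sigma_tilde] and [sigma_hat] together, as sequences of
    the form [b(n) = a(n) - c a(n/2)]. *)
Lemma tempered_depleted (a b : nat -> Z) (c : Z) :
  tempered a -> (forall n, b n = (a n - c * spread 0 a n)%Z) -> tempered b.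
Proof.
  intros Ha Hb.
  apply (tempered_ext (fun n => (a n + - c * spread 0 a n)%Z));
    [intros n; rewrite Hb; ring|].
  apply tempered_add; [|apply tempered_scal, tempered_spread]; exact Ha.
Qed.

Lemma power_series_depleted (a b : nat -> Z) (c : Z) q :
  tempered a -> (forall n, b n = (a n - c * spread 0 a n)%Z) ->
  (Cmod q < 1)%R -> power_series b q = power_series a q - ZtoC c * power_series a (q ^ 2).
Proof.
  intros Ha Hb Hq; assert (Tb := tempered_depleted a b c Ha Hb).
  rewrite (sums_to_unique _ _ _ _ _ (sums_to_power_series b q Tb Hq)
    (sums_to_add _ _ _ _ _ (sums_to_power_series a q Ha Hq)
      (sums_to_scal (- c) _ _ _ (sums_to_spread_power_series a q Ha Hq)))).
  - rewrite ZtoC_opp; ring.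
  - intros n; rewrite Hb; ring.
Qed.

Lemma power_series_theta_depleted (a b : nat -> Z) (c : Z) q :
  tempered a -> (forall n, b n = (a n - c * spread 0 a n)%Z) ->
  (Cmod q < 1)%R ->
  power_series (theta b) q
  = power_series (theta a) q - 2 * ZtoC c * power_series (theta a) (q ^ 2).
Proof.
  intros Ha Hb Hq; assert (Tb := tempered_depleted a b c Ha Hb).
  assert (Ts := tempered_theta _ (tempered_spread _ Ha)).
  rewrite (sums_to_unique _ _ _ _ _
    (sums_to_power_series _ q (tempered_theta _ Tb) Hq)
    (sums_to_add _ _ _ _ _ (sums_to_power_series _ q (tempered_theta _ Ha) Hq)
      (sums_to_scal (- c) _ _ _ (sums_to_power_series _ q Ts Hq)))).
  - rewrite ZtoC_opp, power_series_theta_spread by assumption; ring.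
  - intros n; unfold theta; rewrite Hb; ring.
Qed.

(** The composite [z -> f (z ^ 2)] is itself a power series, with spread
    coefficients, so its derivative is found without the chain rule. *)
Lemma theta_affine_depleted (a b : nat -> Z) (c : Z) (f : C -> C) (k : C) q :
  tempered a -> (forall n, b n = (a n - c * spread 0 a n)%Z) ->
  (Cmod q < 1)%R -> (forall z, (Cmod z < 1)%R -> f z = 1 + k * power_series b z) ->
  (ex_C_derive f q /\ ex_C_derive (fun z => f (z ^ 2)) q) /\
  q * C_derive f q
  = k * (power_series (theta a) q - 2 * ZtoC c * power_series (theta a) (q ^ 2)) /\
  q * C_derive (fun z => f (z ^ 2)) q
  = 2 * k * (power_series (theta a) (q ^ 2)
             - 2 * ZtoC c * power_series (theta a) ((q ^ 2) ^ 2)).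
Proof.
  intros Ha Hb Hq Hf; assert (Tb := tempered_depleted a b c Ha Hb).
  destruct (theta_affine f 1 k b q Tb Hq Hf) as [Ex1 E1].
  destruct (theta_affine (fun z => f (z ^ 2)) 1 k _ q (tempered_spread _ Tb) Hq) as [Ex2 E2].
  { intros z Hz; rewrite Hf by (apply Cmod_sq_lt1, Hz).
    rewrite (has_sum_unique _ _ _ (sums_to_power_series _ z (tempered_spread _ Tb) Hz)
               (sums_to_spread_power_series b z Tb Hz)); reflexivity. }
  split; [split; assumption|].
  rewrite E1, E2, power_series_theta_spread, !(power_series_theta_depleted a b c)
    by (try apply Cmod_sq_lt1; assumption).
  split; ring.
Qed.

(** * Products of values of [L] at [q], [q ^ 2] and [q ^ 4] *)

Local Notation L := (power_series (sigma 1)).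
Local Notation M := (power_series (sigma 3)).
Local Notation D := (power_series (theta (sigma 1))).

Lemma tempered_D : tempered (theta (sigma 1)).
Proof. apply tempered_theta, tempered_sigma. Qed.

Lemma sums_to_L q : (Cmod q < 1)%R -> sums_to (sigma 1) q (L q).
Proof. apply sums_to_power_series, tempered_sigma. Qed.

Lemma sums_to_M q : (Cmod q < 1)%R -> sums_to (sigma 3) q (M q).
Proof. apply sums_to_power_series, tempered_sigma. Qed.

Lemma sums_to_D q : (Cmod q < 1)%R -> sums_to (theta (sigma 1)) q (D q).
Proof. apply sums_to_power_series, tempered_D. Qed.

Lemma L_opp q : (Cmod q < 1)%R ->
  L (- q) = - L q + 6 * L (q ^ 2) - 4 * L ((q ^ 2) ^ 2).
Proof.
  intros Hq; rewrite (power_series_opp _ 6 (-4)); [unfold ZtoC; ring|apply tempered_sigma|exact Hq|].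
  intros n; rewrite sigma_alternating; change (2 ^ Z.of_nat 1)%Z with 2%Z; ring.
Qed.

Lemma M_opp q : (Cmod q < 1)%R ->
  M (- q) = - M q + 18 * M (q ^ 2) - 16 * M ((q ^ 2) ^ 2).
Proof.
  intros Hq; rewrite (power_series_opp _ 18 (-16)); [unfold ZtoC; ring|apply tempered_sigma|exact Hq|].
  intros n; rewrite sigma_alternating; change (2 ^ Z.of_nat 3)%Z with 8%Z; ring.
Qed.

(** This is the operator [q d/dq] applied to [L_opp]: it doubles the coefficient of
    the term at [q ^ 2] and multiplies by four that of the term at [q ^ 4]. *)
Lemma D_opp q : (Cmod q < 1)%R ->
  D (- q) = - D q + 12 * D (q ^ 2) - 16 * D ((q ^ 2) ^ 2).
Proof.
  intros Hq; rewrite (power_series_opp _ 12 (-16)); [unfold ZtoC; ring|apply tempered_D|exact Hq|].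
  intros n.
  assert (H1 := theta_spread (sigma 1) n).
  assert (H2 := theta_spread (spread 0%Z (sigma 1)) n).
  rewrite (spread_ext 0%Z _ _ n (theta_spread (sigma 1))), spread_scal in H2.
  assert (E := f_equal (Z.mul (Z.of_nat n)) (sigma_alternating 1 n)).
  simpl (2 ^ Z.of_nat 1)%Z in E.
  set (d1 := spread 0%Z (theta (sigma 1)) n) in *.
  set (d2 := spread 0%Z (spread 0%Z (theta (sigma 1))) n) in *.
  unfold theta in *.
  destruct (Nat.even n); lia.
Qed.

Lemma L_square q : (Cmod q < 1)%R -> 12 * (L q * L q) = 5 * M q + L q - 6 * D q.
Proof.
  intros Hq.
  assert (Hl := sums_to_scal 12 _ _ _ (sums_to_conv _ _ _ _ _ (tempered_sigma 1)
    (tempered_sigma 1) Hq (sums_to_L q Hq) (sums_to_L q Hq))).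
  assert (Hr := sums_to_add _ _ _ _ _
    (sums_to_add _ _ _ _ _ (sums_to_scal 5 _ _ _ (sums_to_M q Hq)) (sums_to_L q Hq))
    (sums_to_scal (-6) _ _ _ (sums_to_D q Hq))).
  assert (E := sums_to_unique _ _ _ _ _ Hl Hr); unfold ZtoC in E; rewrite E; [ring|].
  intros n; rewrite conv_sigma_sigma; unfold theta; ring.
Qed.

Lemma tempered_hat s : tempered (sigma_hat s).
Proof. exact (tempered_depleted _ _ _ (tempered_sigma s) (sigma_hat_sigma s)). Qed.

Lemma tempered_tilde s : tempered (sigma_tilde s).
Proof. exact (tempered_depleted _ _ _ (tempered_sigma s) (sigma_tilde_sigma s)). Qed.

Lemma power_series_hat s q : (Cmod q < 1)%R ->
  power_series (sigma_hat s) q = power_series (sigma s) q - 2 * power_series (sigma s) (q ^ 2).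
Proof. exact (power_series_depleted _ _ _ q (tempered_sigma s) (sigma_hat_sigma s)). Qed.

Lemma power_series_tilde s q : (Cmod q < 1)%R ->
  power_series (sigma_tilde s) q
  = power_series (sigma s) q - ZtoC (2 ^ Z.of_nat (S s)) * power_series (sigma s) (q ^ 2).
Proof. exact (power_series_depleted _ _ _ q (tempered_sigma s) (sigma_tilde_sigma s)). Qed.

(** The squares are the power series of the two convolutions in [conv_parity_sigma]:
    the coefficients of [L(q) - 2 L(q^2)] are the numbers [sigma_hat_1(n)]. *)
Lemma L_parity_square q : (Cmod q < 1)%R ->
  12 * ((L q - 2 * L (q ^ 2)) * (L q - 2 * L (q ^ 2)) + 4 * (L (q ^ 2) * L (q ^ 2)))
  = M q - L q + 24 * M (q ^ 2) + 6 * L (q ^ 2) - 24 * D (q ^ 2).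
Proof.
  intros Hq.
  assert (T1 := tempered_sigma 1); assert (T3 := tempered_sigma 3).
  assert (Ts := tempered_spread _ T1); assert (Th := tempered_hat 1).
  assert (H2 := sums_to_spread_power_series _ q T1 Hq).
  assert (Hh := sums_to_power_series _ q Th Hq).
  assert (Hl := sums_to_scal 12 _ _ _ (sums_to_add _ _ _ _ _
    (sums_to_conv _ _ _ _ _ Th Th Hq Hh Hh)
    (sums_to_scal 4 _ _ _ (sums_to_conv _ _ _ _ _ Ts Ts Hq H2 H2)))).
  assert (Hr := sums_to_add _ _ _ _ _ (sums_to_add _ _ _ _ _ (sums_to_add _ _ _ _ _
      (sums_to_add _ _ _ _ _ (sums_to_M q Hq) (sums_to_scal (-1) _ _ _ (sums_to_L q Hq)))
      (sums_to_scal 24 _ _ _ (sums_to_spread_power_series _ q T3 Hq)))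
      (sums_to_scal 6 _ _ _ H2))
    (sums_to_scal (-24) _ _ _ (sums_to_spread_power_series _ q tempered_D Hq))).
  assert (E := sums_to_unique _ _ _ _ _ Hl Hr); unfold ZtoC in E.
  rewrite power_series_hat in E by exact Hq; rewrite E; [ring|].
  intros n; rewrite conv_parity_sigma.
  assert (E' := theta_spread (sigma 1) n); unfold theta at 1 in E'; lia.
Qed.

(** In the square [(L(q) - 2 L(q^2))^2] the only product not covered by
    [L_square] is [L(q) L(q^2)]. *)
Lemma L_mul_L2 q : (Cmod q < 1)%R ->
  24 * (L q * L (q ^ 2))
  = 2 * M q + 8 * M (q ^ 2) + L q + L (q ^ 2) - 3 * D q - 12 * D (q ^ 2).
Proof.
  intros Hq.
  assert (H1 := L_square q Hq); assert (H2 := L_square _ (Cmod_sq_lt1 q Hq)).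
  assert (HP := L_parity_square q Hq).
  transitivity (/ 2 * (12 * (L q * L q) + 8 * (12 * (L (q ^ 2) * L (q ^ 2)))
    - 12 * ((L q - 2 * L (q ^ 2)) * (L q - 2 * L (q ^ 2)) + 4 * (L (q ^ 2) * L (q ^ 2)))));
    [field|].
  rewrite H1, H2, HP; field.
Qed.

(** Expand [L_square] at [-q] with [L_opp]: every product that occurs, other than
    [L(q) L(q^4)], is given by [L_square] at [q], [q^2], [q^4] or by [L_mul_L2] at
    [q], [q^2]. *)
Lemma L_mul_L4 q : (Cmod q < 1)%R ->
  48 * (L q * L ((q ^ 2) ^ 2))
  = M q + 3 * M (q ^ 2) + 16 * M ((q ^ 2) ^ 2) + 2 * L q + 2 * L ((q ^ 2) ^ 2)
    - 3 * D q - 48 * D ((q ^ 2) ^ 2).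
Proof.
  intros Hq.
  assert (Hq2 := Cmod_sq_lt1 q Hq); assert (Hq4 := Cmod_sq_lt1 _ Hq2).
  assert (Hqn : (Cmod (- q) < 1)%R) by (rewrite Cmod_opp; exact Hq).
  assert (H1 := L_square q Hq); assert (H2 := L_square _ Hq2); assert (H4 := L_square _ Hq4).
  assert (H12 := L_mul_L2 q Hq); assert (H24 := L_mul_L2 _ Hq2).
  assert (Hn := L_square _ Hqn); rewrite L_opp, M_opp, D_opp in Hn by exact Hq.
  generalize dependent ((q ^ 2) ^ 2); intros q4; intros.
  generalize dependent (q ^ 2); intros q2; intros.
  transitivity (/ 2 * (12 * ((- L q + 6 * L q2 - 4 * L q4) * (- L q + 6 * L q2 - 4 * L q4))
     - 12 * (L q * L q) - 36 * (12 * (L q2 * L q2)) - 16 * (12 * (L q4 * L q4))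
     + 6 * (24 * (L q * L q2)) + 24 * (24 * (L q2 * L q4)))); [field|].
  rewrite Hn, H1, H2, H4, H12, H24; field.
Qed.

(** * The six identities *)

Theorem theorem4p6 (q : C) (hq : (Cmod q < 1)%R) :
  let P := calP in
  let E := calE in
  let Q := calQ in
  let qdP := q * C_derive P q in
  let qdP2 := q * C_derive (fun z => P (z ^ 2)) q in
  let qdE := q * C_derive E q in
  let qdE2 := q * C_derive (fun z => E (z ^ 2)) q in
  (ex_C_derive P q /\ ex_C_derive (fun z => P (z ^ 2)) q /\
   ex_C_derive E q /\ ex_C_derive (fun z => E (z ^ 2)) q) /\
  calP_2 0 q * (- (1) + P q)
    = 1 / 8 + 1 / 16 * (Q q + Q (q ^ 2)) - 1 / 24 * (E q - 7 * E (q ^ 2))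
      - 1 / 2 * P (q ^ 2) + 1 / 2 * qdP - 1 / 12 * (qdE - qdE2) /\
  calP_2 0 q * (- (1) + P (q ^ 2))
    = 1 / 8 + 1 / 8 * (Q (q ^ 2) - 3 * P (q ^ 2) + E (q ^ 2))
      + 1 / 16 * (qdP + 6 * qdP2) - 1 / 48 * (qdE + 2 * qdE2) /\
  calP_2 1 q * (- (1) + P q)
    = 1 / 16 * (Q q - Q (q ^ 2)) - 1 / 24 * (E q - E (q ^ 2))
      + 1 / 12 * (qdE - qdE2) /\
  calP_2 1 q * (- (1) + P (q ^ 2))
    = 1 / 24 * (E (q ^ 2) - E q) + 1 / 24 * (qdE - qdE2) /\
  calE_2 0 q * (- (1) + P q)
    = 1 / 24 + 1 / 16 * (Q (q ^ 2) - 1 / 3 * Q q) - 1 / 24 * P q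
      - 1 / 24 * E (q ^ 2) + 1 / 12 * qdE2 /\
  calE_2 0 q * (- (1) + P (q ^ 2))
    = 1 / 24 + 1 / 24 * (Q (q ^ 2) - P (q ^ 2) - E (q ^ 2))
      + 1 / 24 * qdE2.
Proof.
  cbv zeta.
  assert (hq2 := Cmod_sq_lt1 q hq); assert (hq4 := Cmod_sq_lt1 _ hq2).
  assert (hqn : (Cmod (- q) < 1)%R) by (rewrite Cmod_opp; exact hq).
  assert (hopp : (- q) ^ 2 = q ^ 2) by ring.
  assert (VP : forall z, (Cmod z < 1)%R -> calP z = 1 + 8 * power_series (sigma_tilde 1) z).
  { intros z Hz; unfold calP.
    rewrite (CSeries_succ _ _ _ eq_refl
      (sums_to_power_series _ z (tempered_tilde 1) Hz)); reflexivity. }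
  assert (VE : forall z, (Cmod z < 1)%R -> calE z = 1 + 24 * power_series (sigma_hat 1) z).
  { intros z Hz; unfold calE.
    rewrite (CSeries_succ _ _ _ eq_refl
      (sums_to_power_series _ z (tempered_hat 1) Hz)); reflexivity. }
  assert (VQ : forall z, (Cmod z < 1)%R -> calQ z = 1 - 16 * power_series (sigma_tilde 3) z).
  { intros z Hz; unfold calQ.
    rewrite (CSeries_succ _ _ _ eq_refl
      (sums_to_power_series _ z (tempered_tilde 3) Hz)); reflexivity. }
  assert (EP0 : calP_2 0 q = - L (q ^ 2) - 2 * L ((q ^ 2) ^ 2)).
  { unfold calP_2.
    rewrite (CSeries_even _ _ _ _ (sums_to_power_series _ q (tempered_tilde 1) hq)
               (sums_to_power_series _ (- q) (tempered_tilde 1) hqn)).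
    rewrite !power_series_tilde by assumption; rewrite L_opp, hopp by exact hq.
    change (ZtoC (2 ^ Z.of_nat 2)) with (RtoC 4); field. }
  assert (EP1 : calP_2 1 q = L q - 3 * L (q ^ 2) + 2 * L ((q ^ 2) ^ 2)).
  { unfold calP_2.
    rewrite (CSeries_odd _ _ _ _ (sums_to_power_series _ q (tempered_tilde 1) hq)
               (sums_to_power_series _ (- q) (tempered_tilde 1) hqn)).
    rewrite !power_series_tilde by assumption; rewrite L_opp, hopp by exact hq.
    change (ZtoC (2 ^ Z.of_nat 2)) with (RtoC 4); field. }
  assert (EE0 : calE_2 0 q = L (q ^ 2) - 2 * L ((q ^ 2) ^ 2)).
  { unfold calE_2.
    rewrite (CSeries_even _ _ _ _ (sums_to_power_series _ q (tempered_hat 1) hq)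
               (sums_to_power_series _ (- q) (tempered_hat 1) hqn)).
    rewrite !power_series_hat by assumption; rewrite L_opp, hopp by exact hq; field. }
  destruct (theta_affine_depleted _ _ _ calP 8 q (tempered_sigma 1) (sigma_tilde_sigma 1) hq VP)
    as ([XP XP2] & DP & DP2).
  destruct (theta_affine_depleted _ _ _ calE 24 q (tempered_sigma 1) (sigma_hat_sigma 1) hq VE)
    as ([XE XE2] & DE & DE2).
  split; [repeat split; assumption|].
  rewrite DP, DP2, DE, DE2, EP0, EP1, EE0; clear DP DP2 DE DE2 EP0 EP1 EE0.
  rewrite !VP, !VE, !VQ, !power_series_tilde, !power_series_hat by assumption.
  assert (P11 := L_square q hq); assert (P22 := L_square _ hq2); assert (P44 := L_square _ hq4).
  assert (P12 := L_mul_L2 q hq); assert (P24 := L_mul_L2 _ hq2); assert (P14 := L_mul_L4 q hq).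
  change (ZtoC (2 ^ Z.of_nat 2)) with (RtoC 4).
  change (ZtoC (2 ^ Z.of_nat 4)) with (RtoC 16).
  change (ZtoC 2) with (RtoC 2).
  set (l1 := L q) in *; set (m1 := M q) in *; set (d1 := D q) in *.
  set (l2 := L (q ^ 2)) in *; set (m2 := M (q ^ 2)) in *; set (d2 := D (q ^ 2)) in *.
  set (l4 := L ((q ^ 2) ^ 2)) in *; set (m4 := M ((q ^ 2) ^ 2)) in *;
    set (d4 := D ((q ^ 2) ^ 2)) in *.
  clearbody l1 l2 l4 m1 m2 m4 d1 d2 d4.
  (* A quadratic form in [l1], [l2], [l4] equals the linear form obtained from the
     product formulas.  The coefficients supplied below are those of the expanded
     left-hand sides, divided by the 12, 24 or 48 of the corresponding formula. *)
  assert (reduce : forall c11 c12 c14 c22 c24 c44 x y,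
    x = c11 * (12 * (l1 * l1)) + c12 * (24 * (l1 * l2)) + c14 * (48 * (l1 * l4))
        + c22 * (12 * (l2 * l2)) + c24 * (24 * (l2 * l4)) + c44 * (12 * (l4 * l4)) ->
    c11 * (5 * m1 + l1 - 6 * d1)
    + c12 * (2 * m1 + 8 * m2 + l1 + l2 - 3 * d1 - 12 * d2)
    + c14 * (m1 + 3 * m2 + 16 * m4 + 2 * l1 + 2 * l4 - 3 * d1 - 48 * d4)
    + c22 * (5 * m2 + l2 - 6 * d2)
    + c24 * (2 * m2 + 8 * m4 + l2 + l4 - 3 * d2 - 12 * d4)
    + c44 * (5 * m4 + l4 - 6 * d4) = y ->
    x = y).
  { intros; subst x; rewrite P11, P12, P14, P22, P24, P44; assumption. }
  repeat split.
  - apply (reduce 0 (- / 3) (- / 3) (8 / 3) (8 / 3) 0); field.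
  - apply (reduce 0 0 0 (- (2 / 3)) (2 / 3) (16 / 3)); field.
  - apply (reduce (2 / 3) (- (7 / 3)) (1 / 3) 8 (- (8 / 3)) 0); field.
  - apply (reduce 0 (1 / 3) (- (2 / 3)) (- (2)) (14 / 3) (- (16 / 3))); field.
  - apply (reduce 0 (1 / 3) (- (1 / 3)) (- (8 / 3)) (8 / 3) 0); field.
  - apply (reduce 0 0 0 (2 / 3) (- (2)) (16 / 3)); field.
Qed.
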